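(* Let $X_1,X_2,\dots$ be independent random variables with a common distribution $F$ over $(0,1)$ having density $f$, and let $N$ be independent of $X_1,X_2,\dots$ and Poisson distributed with mean $\lambda$. If $\int_0^1 f(\ln_+ f)^4<\infty$, then the expected number of bit comparisons, call it $\mu_f(\lambda)$, required to sort the keys $X_1,\dots,X_N$ using Quicksort satisfies $$\mu_f(\lambda)=\mu_{\mathrm{unif}}(\lambda)+2H(f)\,\lambda\ln\lambda+o(\lambda\log\lambda)$$ as $\lambda\to\infty$, where $H(f):=\int_0^1 f\lg f\ge 0$ is the entropy (in bits) of the density $f$, and $\mu_{\mathrm{unif}}(\lambda)$ denotes $\mu_f(\lambda)$ in the case that $f\equiv 1$ on $(0,1)$ (the uniform distribution).
   Context: Notation: $\ln$ is the natural logarithm, $\lg$ the binary logarithm, $\ln_+$ the positive part of the natural logarithm; $\log$ is used when the base does not matter; $0\lg 0=0$. Quicksort: to sort an array of $n$ distinct keys, if $n\le 1$ do nothing. If $n\ge 2$, pick a key uniformly at random from the array (independently of everything else), called the pivot; compare each of the other keys to the pivot, thereby partitioning the remaining keys into the subarray of smaller keys and the subarray of larger keys; then recursively apply Quicksort to each of the two subarrays. Bit comparisons: for distinct $x,y\in(0,1)$ let $b(x,y)\in\{1,2,\dots\}$ be the index of the first bit at which the binary expansions of $x$ and $y$ differ (using the terminating expansion for dyadic rationals). A comparison of the keys $x$ and $y$ costs $b(x,y)$ bit comparisons. The number of bit comparisons required to sort a list of keys is the sum of $b(x,y)$ over all pairs of keys $x,y$ compared by Quicksort. *)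

(* Defs.v *)
From HB Require Import structures.
From mathcomp Require Import all_boot all_order all_algebra.
From mathcomp Require Import all_classical all_reals all_analysis.

Set Implicit Arguments.
Unset Strict Implicit.
Unset Printing Implicit Defensive.

Import Order.TTheory GRing.Theory Num.Theory.
Import numFieldNormedType.Exports.

Local Open Scope classical_set_scope.
Local Open Scope ring_scope.

(* Makes the little-o notations available at +oo. *)
Canonical pinfty_filter_on (R : realType) :=
  FilterType (pinfty_nbhs R) (@filter_filter R _ proper_pinfty_nbhs).

Section Bits.
Context {R : realType}.

(* For x in (0,1) and k >= 1, floor (2 ^ k * x) mod 2 is the k-th bit of the
   binary expansion of x, the terminating one when x is dyadic. *)
Definition bit (x : R) (k : nat) : bool := odd (Num.truncn (2 ^+ k * x)).

Definition bits_differ (x y : R) : pred nat :=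
  [pred k | (0 < k)%N && (bit x k != bit y k)].

(* The value 0 is only taken on pairs without a differing bit; for x, y in
   (0,1) this means x = y. *)
Definition first_diff_bit (x y : R) : nat :=
  match pselect (exists k, bits_differ x y k) with
  | left h => ex_minn h
  | right _ => 0%N
  end.

End Bits.

Section Quicksort.
Context {R : realType}.

(* The pairs of keys compared while sorting s. A recursive call is addressed by
   its path v from the root of the recursion tree (false: smaller keys,
   true: larger keys); pivot v n is the position of the pivot selected by the
   call at v when its array has n >= 2 keys. The depth of the recursion is
   bounded by fuel, for which size s is enough. *)
Fixpoint quicksort_comparisons (pivot : seq bool -> nat -> nat) (fuel : nat)
    (v : seq bool) (s : seq R) : seq (R * R) :=
  match fuel with
  | 0%N => [::]
  | m.+1 =>
    if (size s <= 1)%N then [::] else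
    let p := nth 0 s (pivot v (size s)) in
    [seq (p, y) | y <- s & y != p]
      ++ quicksort_comparisons pivot m (rcons v false) [seq y <- s | y < p]
      ++ quicksort_comparisons pivot m (rcons v true) [seq y <- s | p < y]
  end.

Definition bit_comparisons (pivot : seq bool -> nat -> nat) (s : seq R) : nat :=
  (\sum_(xy <- quicksort_comparisons pivot (size s) [::] s)
     first_diff_bit xy.1 xy.2)%N.

End Quicksort.

Section Model.
Context {R : realType}.

Notation mu := (@lebesgue_measure R).

Definition is_density01 (f : R -> R) : Prop :=
  [/\ measurable_fun (`]0, 1[%classic : set R) f,
      (forall x, (`]0, 1[%classic : set R) x -> 0 <= f x) &
      (\int[mu]_(x in `]0%R, 1%R[%classic) (f x)%:E = 1)%E].

(* Mathcomp-analysis has ln x = 0 for x <= 0, so that lnp 0 = 0 and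
   0 * lg 0 = 0. *)
Definition lnp (x : R) : R := Num.max (ln x) 0.
Definition lg (x : R) : R := ln x / ln 2.

Definition entropy (f : R -> R) : \bar R :=
  (\int[mu]_(x in `]0%R, 1%R[%classic) (f x * lg (f x))%:E)%E.

Definition mutually_independent (d : measure_display) (T : measurableType d)
    (P : probability T R) (I : eqType) (F : I -> set_system T) : Prop :=
  forall (s : seq I) (E : I -> set T), uniq s ->
    (forall i, i \in s -> F i (E i)) ->
    (P (\big[setI/setT]_(i <- s) E i) = \prod_(i <- s) P (E i))%E.

Definition generated_by (d : measure_display) (T : measurableType d) (d' : measure_display) (T' : measurableType d')
    (X : T -> T') : set_system T :=
  preimage_set_system setT X measurable.

(* The sources of randomness: the keys X i, their number N, and the pivot
   choices. *)
Definition sources (d : measure_display) (T : measurableType d) (P : probability T R)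
    (X : nat -> {RV P >-> R}) (N : {RV P >-> nat})
    (pivot : seq bool -> nat -> {RV P >-> nat})
    (i : nat + unit + seq bool * nat) : set_system T :=
  match i with
  | inl (inl j) => generated_by (X j)
  | inl (inr _) => generated_by N
  | inr (v, n) => generated_by (pivot v n)
  end.

Record quicksort_model (f : R -> R) (lambda : R) (d : measure_display) (T : measurableType d)
    (P : probability T R) (X : nat -> {RV P >-> R}) (N : {RV P >-> nat})
    (pivot : seq bool -> nat -> {RV P >-> nat}) : Prop := QuicksortModel {
  keys_density : forall i (B : set R), measurable B ->
    P (X i @^-1` B) = (\int[mu]_(x in B `&` `]0%R, 1%R[%classic) (f x)%:E)%E ;
  number_poisson : forall k,
    P [set w | N w = k] = (poisson_pmf lambda k)%:E ;
  pivot_uniform : forall v n k, (k < n)%N ->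
    P [set w | pivot v n w = k] = (n%:R^-1)%:E ;
  model_independent : mutually_independent P (sources X N pivot)
}.

(* m is the expected number of bit comparisons used to sort N keys with
   density f, where N is Poisson with mean lambda. *)
Definition is_mean_bit_comparisons (f : R -> R) (lambda : R) (m : \bar R) :
    Prop :=
  exists (d : measure_display) (T : measurableType d) (P : probability T R)
    (X : nat -> {RV P >-> R}) (N : {RV P >-> nat})
    (pivot : seq bool -> nat -> {RV P >-> nat}),
    quicksort_model f lambda X N pivot /\
    m = ('E_P[fun w => (bit_comparisons (fun v n => pivot v n w)
                          (mkseq (fun i => X i w) (N w)))%:R])%E.

End Model.

(* Main.v *)
(* For keys in (0,1), b(x,y) is the number of levels k >= 0 at which x and y lie
   in the same dyadic interval of length 2^-k, so the cost is the sum over all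
   dyadic intervals I of the number of comparisons between two keys of I.
   Quicksort treats the keys of I as it would alone, whatever the other keys:
   given m keys in I, the mean number of these comparisons is that of sorting m
   keys, C_m = 2 (m+1) H_m - 4 m.  For a Poisson number of keys, m is Poisson of
   mean lambda p_I, with p_I the mass of I, and the mean cost is the sum over I
   of G(lambda p_I), where G(s) is the Poisson mean of C.
   Since G(s) = s (2 ln s + c) + o(s), the levels k < lg lambda contribute
   2 lambda (sum_I p_I ln (2^k p_I)) + o(lambda) more for f than for the uniform
   density.  The inner sum is the integral of g ln g for g the average of f over
   dyadic intervals of level k; it converges to the integral of f ln f (Jensen
   from above, Lebesgue differentiation and Fatou from below), hence so do its
   averages over k < lg lambda.  At the j-th level beyond lg lambda, the bound
   G(s) = O(s min(s, 1 + ln+ s)) and the fourth moment of ln+ f give a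
   contribution O(lambda / (1+j)^2), so that those levels are negligible. *)
Require Import Defs.
From HB Require Import structures.
From mathcomp Require Import all_boot all_order all_algebra.
From mathcomp Require Import ring lra zify.
From mathcomp Require Import all_classical all_reals all_analysis measurable_realfun.

Set Implicit Arguments.
Unset Strict Implicit.
Unset Printing Implicit Defensive.

Import Order.TTheory GRing.Theory Num.Theory.
Import numFieldNormedType.Exports.
Local Open Scope classical_set_scope.
Local Open Scope ring_scope.

(** The keys are real-valued, so the run cannot be conditioned on them by summing over their values.
    It needs only a finite table: which key is smaller than which, and which keys lie in I. Once N
    and this table are fixed, the list may be replaced by that of a single sample point, and only
    the pivots remain random. Pivots are indexed by path and array size, so those drawn on the way
    to a call never occur at or below it; this is the independence that carries an induction over
    the recursion. The keys must also be almost surely distinct, which follows from the estimate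
    used for the levels beyond lg lambda. Errors in the asymptotics of C_m and G have the form theta
    s + A, with theta > 0 arbitrary. Poisson means preserve this form, and a sum over the 2^k
    intervals of a level turns it into theta lambda + 2^k A; summed over k < lg lambda this is theta
    lambda lg lambda + O(lambda). For the entropy, y ln y is shifted by 1 to become nonnegative, so
    that Fatou and comparisons of integrals apply directly. *)

Section QuicksortCost.
Context {R : realType}.

(** * Mean number of Quicksort comparisons on n keys, and its restriction to an interval *)

(** This is the Quicksort recurrence after subtracting two consecutive instances, which leaves only
    the previous term. The sum over pivot ranks is recovered in [qs_mean_rec]. *)
Fixpoint qs_mean (n : nat) : R :=
  if n is m.+1 then (2 * m%:R + (m%:R + 2) * qs_mean m) / m.+1%:R else 0.

Lemma qs_meanS n :
  qs_mean n.+1 * n.+1%:R = 2 * n%:R + (n%:R + 2) * qs_mean n.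
Proof. by rewrite /= divfK// pnatr_eq0. Qed.

Lemma qs_mean_ge0 n : 0 <= qs_mean n.
Proof.
by elim: n => //= n IH; rewrite divr_ge0// addr_ge0// mulr_ge0// addr_ge0.
Qed.

(** The bound is the falling factorial because its Poisson mean is exactly s^2; this yields G(s) <=
    s^2. *)
Lemma qs_mean_le n : qs_mean n <= n%:R * (n%:R - 1).
Proof.
elim: n => [|n IH] /=; first by rewrite mul0r.
rewrite ler_pdivrMr// -[n.+1%:R]natr1.
have := qs_mean_ge0 n; have : 0 <= n%:R :> R by [].
move: (n%:R : R) (qs_mean n) IH => x c IH x0 c0.
have : 0 <= (x + 2) * (x * (x - 1) - c) by rewrite mulr_ge0// ?subr_ge0// addr_ge0.
by nra.
Qed.

(* The quicksort recurrence: n - 1 comparisons with the pivot, whose rank a is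
   uniform on {0, ..., n - 1}. *)
Lemma qs_mean_rec n :
  \sum_(a < n) (n.-1%:R + qs_mean a + qs_mean (n.-1 - a)) = n%:R * qs_mean n.
Proof.
suff H : 2 * \sum_(a < n) qs_mean a = n%:R * (qs_mean n - n.-1%:R).
  rewrite !big_split /= sumr_const card_ord -[_ *+ n]mulr_natr.
  have -> : \sum_(i < n) qs_mean (n.-1 - i) = \sum_(i < n) qs_mean i.
    rewrite [RHS](reindex_inj rev_ord_inj) /=; apply: eq_bigr => i _.
    by congr qs_mean; have := ltn_ord i; lia.
  by rewrite -addrA -mulr2n -[_ *+ 2]mulr_natl H; ring.
elim: n => [|n IH]; first by rewrite big_ord0 mulr0 mul0r.
rewrite big_ord_recr /= mulrDr IH.
rewrite [RHS]mulrBr [_.+1%:R * (_ / _)]mulrC divfK ?pnatr_eq0//.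
case: n {IH} => [|n] /=; first by rewrite !mulr0 !mul0r; ring.
by rewrite -[n.+2%:R]natr1 -[n.+1%:R]natr1; ring.
Qed.

(** In the sorted list the rank of a key is its position, so the ranks run once through 0, ..., n -
    1. *)
Lemma sum_rank (h : nat -> R) (s : seq R) : uniq s ->
  \sum_(p <- s) h (count (fun y : R => y < p) s) = \sum_(a < size s) h a.
Proof.
move=> us; set t := sort <=%O s.
have pst : perm_eq t s by rewrite perm_sort.
have st : sorted <%O t by rewrite lt_sorted_uniq_le sort_uniq us sort_le_sorted.
rewrite -(perm_big _ pst) -(perm_size pst) /= (big_nth 0) big_mkord.
apply: eq_bigr => i _; congr h; rewrite -(permP pst).
exact: (count_lt_nth 0 st (ltn_ord i)).
Qed.

Definition convex_pred (I : pred R) :=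
  forall x y z, I x -> I z -> x < y -> y < z -> I y.

Definition cmp_in (I : pred R) (L : seq (R * R)) : nat :=
  count (fun xy => I xy.1 && I xy.2) L.

Lemma count_lt_gt (s : seq R) (p : R) (I : pred R) : uniq s -> p \in s ->
  count I s = (count I [seq y <- s | (y < p)%R]
               + count I [seq y <- s | (p < y)%R] + I p)%N.
Proof.
move=> us ps; rewrite !count_filter.
rewrite (permP (perm_to_rem ps)) /= (_ : count _ s = count (predI I (fun y : R => y < p)) (rem p s)); last first.
  by rewrite (permP (perm_to_rem ps)) /= ltxx andbF.
rewrite (_ : count (predI I _) s = count (predI I (fun y : R => p < y)) (rem p s)); last first.
  by rewrite (permP (perm_to_rem ps)) /= ltxx andbF.
rewrite addnC; congr addn; rewrite -count_predUI.
rewrite (_ : count (predI _ _) _ = 0%N); last first.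
  by apply/eqP; rewrite -leqn0 leqNgt -has_count; apply/hasPn => y _ /=; case: ltgtP; rewrite ?andbF.
rewrite addn0; apply: eq_in_count => y.
by rewrite mem_rem_uniq// inE => /andP[yp _] /=; rewrite -andb_orr -neq_lt yp andbT.
Qed.

Lemma cmp_in_row (I : pred R) (s : seq R) (p : R) : uniq s -> p \in s ->
  cmp_in I [seq (p, y) | y <- s & y != p] = (I p * (count I s).-1)%N.
Proof.
move=> us ps; rewrite /cmp_in count_map.
transitivity (count (fun y => I p && I y) [seq y <- s | y != p]); first by [].
rewrite (permP (perm_to_rem ps) I) /= (rem_filter _ us).
by case: (I p); rewrite ?mul1n// mul0n count_pred0.
Qed.

(* Keys in an interval I are split only by pivots in I: any other pivot has
   all of I on one side. *)
Lemma qs_mean_split (I : pred R) (s : seq R) : convex_pred I -> uniq s ->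
  \sum_(p <- s) ((I p * (count I s).-1)%:R
     + qs_mean (count I [seq y <- s | y < p])
     + qs_mean (count I [seq y <- s | p < y])) = (size s)%:R * qs_mean (count I s).
Proof.
move=> cI us; set m := count I s.
rewrite (bigID I) /=.
have -> : \sum_(p <- s | ~~ I p) ((I p * m.-1)%:R
     + qs_mean (count I [seq y <- s | y < p])
     + qs_mean (count I [seq y <- s | p < y])) =
   \sum_(p <- s | ~~ I p) qs_mean m.
  rewrite big_seq_cond [RHS]big_seq_cond; apply: eq_bigr => p /andP[ps nIp].
  rewrite (negPf nIp) mul0n add0r.
  have := count_lt_gt I us ps; rewrite (negPf nIp) addn0 -/m.
  have [h1|h1] := posnP (count I [seq y <- s | y < p]).
    by rewrite h1 add0n add0r => ->.
  have [h2|h2] := posnP (count I [seq y <- s | p < y]).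
    by rewrite h2 addn0 addr0 => ->.
  exfalso; move: h1 h2; rewrite -!has_count => /hasP[x].
  rewrite mem_filter => /andP[xp _] Ix /hasP[z]; rewrite mem_filter => /andP[pz _] Iz.
  by move: nIp; rewrite (cI _ _ _ Ix Iz xp pz).
rewrite big_const_seq iter_addr_0 (_ : count (fun i => ~~ I i) s = (size s - m)%N); last by rewrite -(count_predC I s) addKn.
have -> : \sum_(p <- s | I p) ((I p * m.-1)%:R
     + qs_mean (count I [seq y <- s | y < p])
     + qs_mean (count I [seq y <- s | p < y])) = m%:R * qs_mean m.
  rewrite -qs_mean_rec -big_filter.
  have ut : uniq [seq x <- s | I x] by rewrite filter_uniq.
  have mE : size [seq x <- s | I x] = m by rewrite size_filter.
  have := sum_rank (fun a => m.-1%:R + qs_mean a + qs_mean (m.-1 - a)) ut.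
  rewrite mE => <-.
  rewrite big_seq [RHS]big_seq; apply: eq_bigr => p; rewrite mem_filter => /andP[Ip ps].
  rewrite Ip mul1n -!addrA; congr (_ + (qs_mean _ + qs_mean _)).
    by rewrite !count_filter; apply: eq_count => y /=; rewrite andbC.
  rewrite /m (count_lt_gt I us ps) Ip addn1 /=.
  have -> : count (fun y : R => y < p) [seq x <- s | I x] = count I [seq y <- s | y < p].
    by rewrite !count_filter; apply: eq_count => y /=; rewrite andbC.
  by rewrite addKn.
rewrite -[_ *+ (size s - m)]mulr_natl -mulrDl -natrD; congr (_%:R * _).
by rewrite subnKC// count_size.
Qed.

End QuicksortCost.

(** * Functions all of whose preimages are measurable *)

Section DiscreteFunctions.
Context d (T : measurableType d).

(** The codomain carries no sigma-algebra: lists, tables and logs of comparisons can be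
    post-composed with any function. *)
Definition discrete_fun (U : Type) (F : T -> U) :=
  forall B : set U, measurable (F @^-1` B).

Lemma discrete_cst (U : Type) (c : U) : discrete_fun (fun=> c).
Proof.
move=> B; rewrite (_ : _ @^-1` _ = [set _ | B c]) //.
by have [Bc|nBc] := pselect (B c);
  [rewrite (_ : [set _ | _] = setT)|rewrite (_ : [set _ | _] = set0)] => //;
  apply/seteqP; split.
Qed.

Lemma discrete_comp (U V : Type) (g : U -> V) (F : T -> U) :
  discrete_fun F -> discrete_fun (fun w => g (F w)).
Proof. by move=> dF B; exact: (dF (g @^-1` B)). Qed.

(** The preimage is a countable union over the values of F. A random computation may thus branch on
    countable data, one branch being treated at a time. *)
Lemma discrete_bind (K : countType) (U : Type) (F : T -> K) (G : K -> T -> U) :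
  discrete_fun F -> (forall k, discrete_fun (G k)) ->
  discrete_fun (fun w => G (F w) w).
Proof.
move=> dF dG B.
rewrite (_ : _ @^-1` _ = \bigcup_k (F @^-1` [set k] `&` G k @^-1` B)).
  apply: countable_bigcupT_measurable; first exact: countableP.
  by move=> k; apply: measurableI; [exact: dF|exact: dG].
apply/seteqP; split => [w Bw|w [k _ [/= <-]]] //.
by exists (F w).
Qed.

Lemma discrete_map (A : Type) (K : countType) (g : A -> T -> K) (s : seq A) :
  (forall a, discrete_fun (g a)) -> discrete_fun (fun w => [seq g a w | a <- s]).
Proof.
move=> dg; elim: s => [|a s IH] /=; first exact: discrete_cst.
apply: (discrete_bind (G := fun k w => k :: [seq g a w | a <- s])) => // k.
exact: discrete_comp IH.
Qed.

Lemma discrete_measurable d' (T' : measurableType d') (F : T -> T') :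
  discrete_fun F -> measurable_fun setT F.
Proof. by move=> dF _ B _; rewrite setTI; exact: dF. Qed.

Lemma measurable_bool_discrete (F : T -> bool) :
  measurable [set w | F w] -> discrete_fun F.
Proof.
move=> mF B.
have -> : F @^-1` B = (if `[< B true >] then [set w | F w] else set0) `|`
    (if `[< B false >] then ~` [set w | F w] else set0).
  apply/seteqP; split => w /=; case E : (F w) => Bb.
  - by left; rewrite asboolT.
  - by right; rewrite asboolT //= E.
  - by case: Bb; case: asboolP => //= _; rewrite E.
  - by case: Bb; case: asboolP => //= _; rewrite E.
by apply: measurableU; case: ifP => // _; exact: measurableC.
Qed.

End DiscreteFunctions.

(** * Quicksort on positions, where the keys enter only through their order *)

Section IndexedQuicksort.
Context {R : realType}.

(* quicksort_comparisons on positions instead of keys; d is a position whose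
   key is the default value 0 used by an out-of-range pivot. *)
Fixpoint qs_idx (lt : rel nat) (d : nat) (pivot : seq bool -> nat -> nat)
    (fuel : nat) (v : seq bool) (s : seq nat) : seq (nat * nat) :=
  match fuel with
  | 0%N => [::]
  | m.+1 =>
    if (size s <= 1)%N then [::] else
    let p := nth d s (pivot v (size s)) in
    [seq (p, y) | y <- s & lt y p || lt p y]
      ++ qs_idx lt d pivot m (rcons v false) [seq y <- s | lt y p]
      ++ qs_idx lt d pivot m (rcons v true) [seq y <- s | lt p y]
  end.

Lemma qs_idxE (x : nat -> R) d pivot m v s : x d = 0 ->
  quicksort_comparisons pivot m v (map x s) =
  [seq (x ij.1, x ij.2) | ij <- qs_idx (fun i j => x i < x j) d pivot m v s].
Proof.
move=> xd; elim: m v s => [//|m IH] v s /=; rewrite size_map.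
case: ifP => // _.
have -> : nth 0 (map x s) (pivot v (size s)) = x (nth d s (pivot v (size s))).
  have [h|h] := ltnP (pivot v (size s)) (size s); first by rewrite (nth_map d).
  by rewrite !nth_default ?size_map.
rewrite !map_cat -!IH !filter_map -!map_comp; congr (_ ++ _).
rewrite (@eq_filter _ _ (fun y => (x y < x (nth d s (pivot v (size s)))) || (x (nth d s (pivot v (size s))) < x y))) //.
by move=> y /=; rewrite neq_lt.
Qed.

Lemma mem_qs_idx lt d pivot m v s ij :
  ij \in qs_idx lt d pivot m v s -> ij.1 \in d :: s /\ ij.2 \in d :: s.
Proof.
elim: m v s => [//|m IH] v s /=; case: ifP => // _.
have sub (P : pred nat) i : i \in d :: [seq y <- s | P y] -> i \in d :: s.
  by rewrite !inE mem_filter => /orP[->//|/andP[_ ->]]; rewrite orbT.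
rewrite !mem_cat => /orP[/mapP[y]|/orP[|] /IH[/sub ? /sub ?]//].
rewrite mem_filter => /andP[_ ys] -> /=; split; last by rewrite inE ys orbT.
have [h|h] := ltnP (pivot v (size s)) (size s); first by rewrite inE mem_nth ?orbT.
by rewrite nth_default ?mem_head.
Qed.

(** Only the order of the positions of s and of the default position d is ever consulted, so the
    order of the keys may be replaced by a finite table. *)
Lemma eq_qs_idx lt lt' d pivot m v s :
  {in d :: s &, lt =2 lt'} ->
  qs_idx lt d pivot m v s = qs_idx lt' d pivot m v s.
Proof.
elim: m v s => [//|m IH] v s e /=; case: ifP => // _.
set p := nth d s _.
have pd : p \in d :: s.
  rewrite /p; have [h|h] := ltnP (pivot v (size s)) (size s).
    by rewrite inE mem_nth ?orbT.
  by rewrite nth_default ?mem_head.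
have e1 : {in s, forall y, lt y p = lt' y p}.
  by move=> y ys; apply: e; rewrite // inE ys orbT.
have e2 : {in s, forall y, lt p y = lt' p y}.
  by move=> y ys; apply: e; rewrite // inE ys orbT.
rewrite (@eq_in_filter _ (fun y => lt y p || lt p y) (fun y => lt' y p || lt' p y)); last first.
  by move=> y ys; rewrite e1 ?e2.
rewrite (eq_in_filter e1) (eq_in_filter e2).
have sub (P : pred nat) i : i \in d :: [seq y <- s | P y] -> i \in d :: s.
  by rewrite !inE mem_filter => /orP[->//|/andP[_ ->]]; rewrite orbT.
by rewrite !IH// => i j /sub hi /sub hj; exact: e.
Qed.

End IndexedQuicksort.

Lemma discrete_qs_idx d (T : measurableType d)
    (pivot : seq bool -> nat -> T -> nat) lt d0 m v s :
  (forall v n, discrete_fun (pivot v n)) ->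
  discrete_fun (fun w => qs_idx lt d0 (fun v n => pivot v n w) m v s).
Proof.
move=> dp; elim: m v s => [|m IH] v s /=; first exact: discrete_cst.
case: (leqP (size s) 1) => _; first exact: discrete_cst.
apply: (discrete_bind (G := fun k w => [seq (nth d0 s k, y) | y <- s & lt y (nth d0 s k) || lt (nth d0 s k) y]
   ++ qs_idx lt d0 (fun v n => pivot v n w) m (rcons v false) [seq y <- s | lt y (nth d0 s k)]
   ++ qs_idx lt d0 (fun v n => pivot v n w) m (rcons v true) [seq y <- s | lt (nth d0 s k) y])) => // k.
set a := map _ _.
apply: (discrete_bind (G := fun b w => a ++ b
   ++ qs_idx lt d0 (fun v n => pivot v n w) m (rcons v true) [seq y <- s | lt (nth d0 s k) y]) (IH _ _)) => b.
exact: (discrete_comp (fun c => a ++ b ++ c) (IH _ _)).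
Qed.

(** * Mean number of comparisons inside an interval, for a fixed list of keys *)

Section PivotExpectation.
Local Open Scope ereal_scope.
Context {R : realType} d (T : measurableType d) (P : probability T R).

Lemma integral_discrete_split (G : set T) (K : T -> nat) n (f : T -> \bar R) :
  measurable G -> discrete_fun K -> P [set w | (n <= K w)%N] = 0 ->
  measurable_fun [set: T] f -> (forall w, 0 <= f w) ->
  \int[P]_(w in G) f w =
  \sum_(i <- iota 0 n) \int[P]_(w in G `&` [set w | K w = i]) f w.
Proof.
move=> mG dK K0 mf f0.
have mK i : measurable (G `&` [set w | K w = i]).
  by apply: measurableI => //; exact: (dK [set i]).
rewrite (@ge0_negligible_integral _ _ _ _ G [set w | (n <= K w)%N])//; last 2 first.
- exact: (dK [set i | (n <= i)%N]).
- exact: measurable_funTS.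
rewrite -(@ge0_integral_bigsetU _ _ _ P nat)//.
- congr (integral _ _ _); rewrite -bigcup_seq; apply/seteqP; split => [w [Gw /= Kw]|w [i /=]].
    by exists (K w) => //=; rewrite mem_iota /= ltnNge; apply/negP.
  by rewrite mem_iota /= => i_n [Gw ->]; split => //; apply/negP; rewrite -ltnNge.
- exact: iota_uniq.
- by move=> i j _ _ [w [[_ <-] [_ <-]]].
- exact: measurable_funTS.
Qed.

Variable pivot : seq bool -> nat -> T -> nat.
Hypothesis dpivot : forall v n, discrete_fun (pivot v n).
Hypothesis pivot_unif : forall v n k, (k < n)%N ->
  P [set w | pivot v n w = k] = (n%:R^-1)%:E.

(* G is independent of the choices made at or below the call at v. *)
Definition pivot_indep (v : seq bool) (G : set T) :=
  measurable G /\
  forall (l : seq (seq bool * nat)) (k : seq bool * nat -> nat), uniq l ->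
    all (fun i => prefix v i.1) l ->
    P (G `&` \big[setI/setT]_(i <- l) [set w | pivot i.1 i.2 w = k i]) =
    P G * \prod_(i <- l) P [set w | pivot i.1 i.2 w = k i].

(** The path v is a strict prefix of its children's paths, so the choice [(v, n)] is not among those
    at or below a child. It can be prepended to any list of such choices, and the independence of G
    applied to the longer list. *)
Lemma pivot_indep_step v G n i : pivot_indep v G -> (i < n)%N ->
  P (G `&` [set w | pivot v n w = i]) = P G * (n%:R^-1)%:E /\
  forall b, pivot_indep (rcons v b) (G `&` [set w | pivot v n w = i]).
Proof.
move=> [mG iG] i_n.
have E : P (G `&` [set w | pivot v n w = i]) = P G * (n%:R^-1)%:E.
  have := iG [:: (v, n)] (fun=> i); rewrite !big_seq1 /= prefix_refl => ->//.
  by rewrite pivot_unif.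
split=> // b; split; first by apply: measurableI => //; exact: (dpivot v n [set i]).
move=> l k ul /allP pl.
have vnl : (v, n) \notin l.
  apply/negP => /pl /=; rewrite prefixE => /eqP /(congr1 size).
  by rewrite size_take size_rcons ltnNge leqnSn/= => /eqP; rewrite ltn_eqF.
have := iG ((v, n) :: l) (fun j => if j == (v, n) then i else k j).
rewrite !big_cons /= eqxx vnl ul prefix_refl => /(_ isT) H.
rewrite E -setIA.
have el : {in l, forall j, (j == (v, n)) = false}.
  by move=> j jl; apply/negP => /eqP jE; move: vnl; rewrite -jE jl.
move: H; rewrite pivot_unif// muleA.
under [in X in P (_ `&` (_ `&` X))]eq_big_seq => j jl do rewrite el//.
under [in X in _ = _ * X]eq_big_seq => j jl do rewrite el//.
apply; apply/allP => j /pl /=; apply: prefix_trans.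
exact: prefix_rcons.
Qed.

(** The values below n, each of probability 1/n, already have total mass 1. *)
Lemma pivot_range v n : (0 < n)%N -> P [set w | (n <= pivot v n w)%N] = 0.
Proof.
move=> n0.
have H : P [set w | (pivot v n w < n)%N] = 1.
  have -> : [set w | (pivot v n w < n)%N] = \big[setU/set0]_(i < n) [set w | pivot v n w = i].
    rewrite -(bigcup_mkord n (fun i => [set w | pivot v n w = i])).
    apply/seteqP; split => [w /= h|w [i h /= ->]//].
    by exists (pivot v n w).
  rewrite (measure_bigsetU P (F := fun i => [set w | pivot v n w = i])); last 2 first.
  - by move=> i; exact: (dpivot v n [set i]).
  - by move=> i j _ _ [w [/= <- <-]].
  rewrite (eq_bigr (fun=> (n%:R^-1)%:E)); last by move=> i _; exact: pivot_unif.
  rewrite sumEFin sumr_const card_ord -[(_ *+ n)%R]mulr_natr mulVf//.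
  by rewrite pnatr_eq0 -lt0n.
have -> : [set w | (n <= pivot v n w)%N] = ~` [set w | (pivot v n w < n)%N].
  by apply/seteqP; split => w /= h; [apply/negP; rewrite -leqNgt|rewrite leqNgt; apply/negP].
by rewrite probability_setC ?H ?subee//; exact: (dpivot v n [set i | (i < n)%N]).
Qed.

Lemma discrete_cmp_in (I : pred R) m v (s : seq R) :
  discrete_fun (fun w => cmp_in I (quicksort_comparisons (fun v n => pivot v n w) m v s)).
Proof.
have -> : s = map (nth 0%R s) (iota 0 (size s)) by rewrite -/(mkseq _ _) mkseq_nth.
(* Position [size s] is past the end, so its key is the default 0 read by an out-of-range pivot. *)
under eq_fun do rewrite (@qs_idxE _ _ (size s)) ?nth_default//.
exact: (discrete_comp (fun L => cmp_in I [seq (nth 0%R s ij.1, nth 0%R s ij.2) | ij <- L])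
  (discrete_qs_idx _ _ _ _ _ dpivot)).
Qed.

Lemma measurable_cmp_in (I : pred R) m v (s : seq R) :
  measurable_fun [set: T] (fun w => (cmp_in I
    (quicksort_comparisons (fun v n => pivot v n w) m v s))%:R%:E : \bar R).
Proof.
apply/measurable_EFinP/discrete_measurable.
exact: (discrete_comp (fun n : nat => n%:R : R) (discrete_cmp_in _ _ _ _)).
Qed.

(** Splitting on the pivot chosen at v reduces the claim to [qs_mean_split]. It is stated on an
    event G because the recursive calls live on the event that fixes the pivots along the path. *)
Lemma mean_cmp_in (I : pred R) m v (s : seq R) (G : set T) :
  convex_pred I -> uniq s -> (size s <= m)%N -> pivot_indep v G ->
  \int[P]_(w in G) (cmp_in I
    (quicksort_comparisons (fun v n => pivot v n w) m v s))%:R%:E =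
  (qs_mean (count I s))%:E * P G.
Proof.
move=> cI; elim: m v s G => [|m IH] v s G us sm iG.
  by move: sm; rewrite leqn0 => /nilP -> /=; rewrite integral0 mul0e.
have [s1|s1] := leqP (size s) 1.
  under eq_integral do rewrite /= s1 /=.
  rewrite integral0; have := count_size I s; case: (count I s) => [|[|c]] //=.
  - by rewrite mul0e.
  - by rewrite !mulr0 addr0 mul0r mul0e.
  - by move=> /leq_trans /(_ s1).
have mG := iG.1.
set n := size s.
have n0 : (0 < n)%N by rewrite (ltn_trans _ s1).
rewrite (integral_discrete_split mG (dpivot v n) (pivot_range v n0)
  (measurable_cmp_in I m.+1 v s)) //.
transitivity (\sum_(i <- iota 0 n) (((I (nth 0%R s i) * (count I s).-1)%:R
     + qs_mean (count I [seq y <- s | (y < nth 0 s i)%R])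
     + qs_mean (count I [seq y <- s | (nth 0 s i < y)%R]))%:E * (P G * (n%:R^-1)%:E))).
  apply: eq_big_seq => i; rewrite mem_iota add0n /= => i_n.
  have [E iGi] := pivot_indep_step iG i_n.
  set Gi := G `&` _ in E iGi *; set p := nth 0%R s i.
  have ps : p \in s by exact: mem_nth.
  have szl : (size [seq y <- s | (y < p)%R] <= m)%N.
    have := count_lt_gt predT us ps; rewrite !count_predT addn1 => h.
    by rewrite -ltnS (leq_trans _ sm)// h ltnS leq_addr.
  have szr : (size [seq y <- s | (p < y)%R] <= m)%N.
    have := count_lt_gt predT us ps; rewrite !count_predT addn1 => h.
    by rewrite -ltnS (leq_trans _ sm)// h ltnS leq_addl.
  rewrite (eq_integral (fun w =>
     (I p * (count I s).-1)%:R%:E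
    + (cmp_in I (quicksort_comparisons (fun v n => pivot v n w) m (rcons v false) [seq y <- s | (y < p)%R]))%:R%:E
    + (cmp_in I (quicksort_comparisons (fun v n => pivot v n w) m (rcons v true) [seq y <- s | (p < y)%R]))%:R%:E)); last first.
    move=> w; rewrite inE => -[_ /= piv]; rewrite leqNgt s1/= piv -/p.
    by rewrite -(cmp_in_row I us ps) /cmp_in !count_cat -!EFinD -!natrD addnA.
  have mGi : measurable Gi by case: (iGi true).
  rewrite !ge0_integralD//; try exact/measurable_funTS/measurable_cmp_in; last first.
  - apply: emeasurable_funD; first exact: measurable_cst.
    exact/measurable_funTS/measurable_cmp_in.
  - by move=> w _; rewrite adde_ge0// lee_fin.
  rewrite integral_cst// !IH ?filter_uniq// E [X in _ * X + _ + _]E.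
  rewrite -(fineK (fin_num_measure P _ mG)) -!EFinM -!EFinD; congr _%:E.
  by rewrite !mulrDl.
rewrite -(fineK (fin_num_measure P _ mG)) -EFinM.
under eq_bigr do rewrite -EFinM.
rewrite sumEFin -mulr_suml; congr _%:E.
have := qs_mean_split cI us; rewrite (big_nth 0%R) /index_iota subn0 -/n => ->.
rewrite mulrA [(n%:R * _)%R]mulrC -[(_ * n%:R * _)%R]mulrA [(n%:R * _)%R]mulrC.
by rewrite mulrA mulfK// pnatr_eq0 -lt0n (ltn_trans _ s1).
Qed.

End PivotExpectation.

(** * Order and membership patterns of random keys *)

Section Patterns.
Context {R : realType}.

(** The table has n + 1 rows and columns: position n stands for the default key. *)
Definition order_pattern (x : nat -> R) n : seq (seq bool) :=
  [seq [seq x i < x j | j <- iota 0 n.+1] | i <- iota 0 n.+1].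

Definition member_pattern (I : pred R) (x : nat -> R) n : seq bool :=
  [seq I (x i) | i <- iota 0 n.+1].

Definition pattern I x n := (order_pattern x n, member_pattern I x n).

Definition pattern_lt (o : seq (seq bool)) : rel nat :=
  fun i j => nth false (nth [::] o i) j.

Lemma order_patternE x n i j : (i <= n)%N -> (j <= n)%N ->
  pattern_lt (order_pattern x n) i j = (x i < x j).
Proof.
move=> i_n j_n; rewrite /pattern_lt /order_pattern (nth_map 0%N) ?size_iota//.
by rewrite (nth_map 0%N) ?size_iota// !nth_iota.
Qed.

Lemma member_patternE I x n i : (i <= n)%N ->
  nth false (member_pattern I x n) i = I (x i).
Proof. by move=> i_n; rewrite (nth_map 0%N) ?size_iota// nth_iota. Qed.

Lemma discrete_order_pattern d (T : measurableType d) (x : T -> nat -> R) n :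
  (forall i, measurable_fun [set: T] (fun w => x w i)) ->
  discrete_fun (fun w => order_pattern (x w) n).
Proof.
move=> mx; apply: discrete_map => i; apply: discrete_map => j.
apply: measurable_bool_discrete.
have := measurable_fun_ltr (mx i) (mx j).
by move=> /(_ measurableT [set true] Logic.I); rewrite setTI.
Qed.

Lemma discrete_pattern d (T : measurableType d) (I : pred R) (x : T -> nat -> R) n :
  (forall i, measurable_fun [set: T] (fun w => x w i)) ->
  measurable [set x | I x] ->
  discrete_fun (fun w => pattern I (x w) n).
Proof.
move=> mx mI.
apply: (discrete_bind (G := fun o w => (o, member_pattern I (x w) n))).
  exact: discrete_order_pattern.
move=> o; apply: (discrete_comp (fun b => (o, b))).
apply: discrete_map => i; apply: measurable_bool_discrete.
by have := mx i measurableT _ mI; rewrite setTI.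
Qed.

Lemma comparisons_pattern (x : nat -> R) n pivot m v : x n = 0 ->
  quicksort_comparisons pivot m v (mkseq x n) =
  [seq (x ij.1, x ij.2) |
    ij <- qs_idx (pattern_lt (order_pattern x n)) n pivot m v (iota 0 n)].
Proof.
move=> xn; rewrite /mkseq (qs_idxE _ _ _ _ xn); congr map; apply: eq_qs_idx.
have le_n i : i \in n :: iota 0 n -> (i <= n)%N.
  by rewrite inE mem_iota /= => /predU1P[->//|/ltnW].
by move=> i j /le_n i_n /le_n j_n; rewrite order_patternE.
Qed.

Definition pattern_cmp_in (b : seq bool) (L : seq (nat * nat)) : nat :=
  count (fun ij => nth false b ij.1 && nth false b ij.2) L.

Lemma cmp_in_pattern (I : pred R) (x : nat -> R) n pivot m v : x n = 0 ->
  cmp_in I (quicksort_comparisons pivot m v (mkseq x n)) =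
  pattern_cmp_in (member_pattern I x n)
    (qs_idx (pattern_lt (order_pattern x n)) n pivot m v (iota 0 n)).
Proof.
move=> xn; rewrite comparisons_pattern// /cmp_in /pattern_cmp_in count_map.
have le_n i : i \in n :: iota 0 n -> (i <= n)%N.
  by rewrite inE mem_iota /= => /predU1P[->//|/ltnW].
by apply: eq_in_count => ij /mem_qs_idx[/le_n h1 /le_n h2] /=; rewrite !member_patternE.
Qed.

Lemma count_pattern (I : pred R) (x : nat -> R) n :
  count I (mkseq x n) = count (nth false (member_pattern I x n)) (iota 0 n).
Proof.
rewrite /mkseq count_map; apply: eq_in_count => i; rewrite mem_iota /= => /ltnW i_n.
by rewrite member_patternE.
Qed.

End Patterns.

(** * Independence of key patterns, number of keys and pivots *)

Section ModelIndependence.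
Local Open Scope ereal_scope.
Context {R : realType} (f : R -> R) (lambda : R) d (T : measurableType d)
  (P : probability T R) (X : nat -> {RV P >-> R}) (N : {RV P >-> nat})
  (pivot : seq bool -> nat -> {RV P >-> nat}).
Hypothesis model : quicksort_model f lambda X N pivot.

Lemma generated_by_preimage d' (T' : measurableType d') (Y : T -> T') B :
  measurable B -> generated_by Y (Y @^-1` B).
Proof. by move=> mB; exists B => //; rewrite setTI. Qed.

Lemma RV_discrete (Y : {RV P >-> nat}) : discrete_fun Y.
Proof. by move=> B; rewrite -[_ @^-1` _]setTI; exact: (measurable_funPT Y). Qed.

Lemma RV_measurable (Y : {RV P >-> R}) B : measurable B -> measurable (Y @^-1` B).
Proof. by move=> mB; rewrite -[_ @^-1` _]setTI; exact: (measurable_funPT Y). Qed.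

Definition rect n (B : 'I_n -> set R) : set T :=
  \big[setI/setT]_(j < n) (X j @^-1` B j).

Definition rects n : set (set T) :=
  [set A | exists2 B : 'I_n -> set R, (forall j, measurable (B j)) & A = rect B].

Definition pivot_event (l : seq (seq bool * nat)) (k : seq bool * nat -> nat) : set T :=
  \big[setI/setT]_(i <- l) [set w | pivot i.1 i.2 w = k i].

Lemma measurable_rect n (B : 'I_n -> set R) :
  (forall j, measurable (B j)) -> measurable (rect B).
Proof. by move=> mB; apply: bigsetI_measurable => j _; exact: RV_measurable. Qed.

Lemma measurable_pivot_event l k : measurable (pivot_event l k).
Proof.
by apply: bigsetI_measurable => i _; exact: (RV_discrete (pivot i.1 i.2) [set k i]).
Qed.

Lemma rect_indep n (B : 'I_n -> set R) m l k : uniq l ->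
  (forall j, measurable (B j)) ->
  P (rect B `&` ([set w | N w = m] `&` pivot_event l k)) =
  \prod_(j < n) P (X j @^-1` B j) *
  (P [set w | N w = m] * \prod_(i <- l) P [set w | pivot i.1 i.2 w = k i]).
Proof.
move=> ul mB.
pose s : seq (nat + unit + seq bool * nat) :=
  [seq inl (inl (val j)) | j <- index_enum 'I_n] ++ inl (inr tt) :: [seq inr i | i <- l].
(* The sources form one family over all key indices, so B is extended beyond n by the full set. *)
pose B' (j : nat) : set R := if insub j is Some j' then B j' else setT.
pose E (i : nat + unit + seq bool * nat) : set T := match i with
  | inl (inl j) => X j @^-1` B' j
  | inl (inr _) => [set w | N w = m]
  | inr i => [set w | pivot i.1 i.2 w = k i] end.
have B'E (j : 'I_n) : B' j = B j by rewrite /B' valK.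
have := model_independent model (s := s) (E := E).
rewrite /s !big_cat !big_cons !big_map /=.
under eq_bigr do rewrite B'E.
under [in X in _ = X * _]eq_bigr do rewrite B'E.
apply.
  rewrite cat_uniq map_inj_uniq ?index_enum_uniq/=; last first.
    by move=> i j [/val_inj].
  apply/andP; split; last first.
    rewrite map_inj_uniq ?ul ?andbT; last by move=> i j [].
    by apply/mapP => -[].
  by apply/norP; split; [|apply/hasPn => _ /mapP[i _ ->]]; apply/mapP => -[].
move=> [[j|u]|i] /= _.
- apply: generated_by_preimage; rewrite /B'; case: insubP => //.
- by exists [set m] => //; rewrite setTI.
- by case: i => v n'; exists [set k (v, n')] => //; rewrite setTI.
Qed.

Lemma rect_prob n (B : 'I_n -> set R) : (forall j, measurable (B j)) ->
  P (rect B) = \prod_(j < n) P (X j @^-1` B j).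
Proof.
move=> mB; pose B' (j : nat) : set R := if insub j is Some j' then B j' else setT.
have B'E (j : 'I_n) : B' j = B j by rewrite /B' valK.
have := model_independent model
  (s := [seq inl (inl (val j)) | j <- index_enum 'I_n])
  (E := fun i => if i is inl (inl j) then X j @^-1` B' j else setT).
rewrite !big_map /=.
under eq_bigr do rewrite B'E.
under [in X in _ = X]eq_bigr do rewrite B'E.
apply; first by rewrite map_inj_uniq ?index_enum_uniq// => i j [/val_inj].
move=> _ /mapP[j _ ->]; apply: generated_by_preimage.
by rewrite /B'; case: insubP.
Qed.

(** With H the event on N and the pivots, the finite measures P(A and H) and P(H) P(A) agree on
    rectangles, which are closed under intersection. Hence they agree on the sigma-algebra of the
    first n keys. *)
Lemma rects_indep n m l k (E : set T) : uniq l -> <<s rects n >> E ->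
  P (E `&` ([set w | N w = m] `&` pivot_event l k)) =
  P E * (P [set w | N w = m] * \prod_(i <- l) P [set w | pivot i.1 i.2 w = k i]).
Proof.
move=> ul sE; set H := _ `&` pivot_event l k.
have mH : measurable H.
  by apply: measurableI; [exact: (RV_discrete N [set m])|exact: measurable_pivot_event].
have PH : P H = P [set w | N w = m] * \prod_(i <- l) P [set w | pivot i.1 i.2 w = k i].
  (* The case of no keys gives the probability of H itself. *)
  have := @rect_indep 0 (fun=> setT) m l k ul; rewrite /rect !big_ord0 setTI mul1e.
  by apply.
rewrite -PH muleC.
have Pfin : P H \is a fin_num by exact: fin_num_measure.
have PH0 : (0 <= fine (P H))%R by exact: fine_ge0.
have G0 : rects n setT.
  exists (fun=> setT) => //; rewrite /rect big1//.
have mscaleE A : mscale (NngNum PH0) P A = P H * P A by rewrite /mscale /= fineK.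
suff : mrestr P mH E = mscale (NngNum PH0) P E.
  by rewrite mscaleE.
apply: (@g_sigma_algebra_measure_unique _ _ _ (rects n) _ (fun=> setT) _ _
  (mrestr P mH) (mscale (NngNum PH0) P)) => //.
- by move=> A [B mB ->]; exact: measurable_rect.
- by rewrite bigcup_const.
- move=> A B [A' mA ->] [B' mB ->]; exists (fun j => A' j `&` B' j).
    by move=> j; exact: measurableI.
  by rewrite /rect -big_split.
- move=> A [B mB ->]; apply: etrans (esym (mscaleE _)).
  change (P (rect B `&` H) = P H * P (rect B)); rewrite PH rect_indep// rect_prob//.
  by rewrite muleC.
- by move=> _; change (P (setT `&` H) < +oo); rewrite setTI -ge0_fin_numE.
Qed.

(* The key 0 at position n is the one read by an out-of-range pivot. *)
Definition key_at n (w : T) (i : nat) : R := if (i < n)%N then X i w else 0%R.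

Lemma measurable_key_at n i : measurable_fun [set: T] (fun w => key_at n w i).
Proof.
rewrite /key_at; case: (ltnP i n) => _; last exact: measurable_cst.
exact: measurable_funPT.
Qed.

(** [discrete_pattern] is applied to the sample space carrying only the sigma-algebra of the first n
    keys; this places pattern events within reach of [rects_indep]. *)
Lemma rects_discrete_pattern (I : pred R) n (U : Type)
    (F : seq (seq bool) * seq bool -> U) (B : set U) :
  measurable [set x | I x] ->
  <<s rects n >> [set w | B (F (pattern I (key_at n w) n))].
Proof.
move=> mI; pose T' := g_sigma_algebraType (rects n).
suff mX i : measurable_fun [set: T'] (fun w : T' => key_at n w i).
  by have /(_ (F @^-1` B)) := @discrete_pattern _ _ T' I (key_at n) n mX mI.
rewrite /key_at; case: (ltnP i n) => i_n; last exact: measurable_cst.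
move=> _ C mC; rewrite setTI; apply: sub_sigma_algebra.
exists (fun j : 'I_n => if j == Ordinal i_n then C else setT).
  by move=> j; case: ifP.
rewrite /rect (bigD1 (Ordinal i_n)) //= eqxx big1 ?setIT//.
by move=> j /negPf ->.
Qed.

(** These are the events on which [mean_cmp_in] is started, at the root of the recursion. *)
Lemma pattern_pivot_indep (I : pred R) n u : measurable [set x | I x] ->
  pivot_indep P (fun v n => pivot v n) [::]
    ([set w | N w = n] `&` [set w | pattern I (key_at n w) n = u]).
Proof.
move=> mI; have sE := @rects_discrete_pattern I n _ id [set u] mI.
split.
  apply: measurableI; first exact: (RV_discrete N [set n]).
  apply: (smallest_sub _ _ sE); first exact: sigma_algebra_measurable.
  by move=> A [B mB ->]; exact: measurable_rect.
move=> l k ul _; rewrite [[set w | N w = n] `&` _]setIC -setIA.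
rewrite (@rects_indep n n l k _ ul sE) muleA; congr (_ * _).
by have := @rects_indep n n [::] (fun=> 0%N) _ isT sE;
  rewrite /pivot_event !big_nil setIT mule1.
Qed.

End ModelIndependence.

(** * Integration over countable partitions *)

Section CountablePartition.
Local Open Scope ereal_scope.
Context {R : realType} d (T : measurableType d) (P : {measure set T -> \bar R}).

Lemma eq_integral_partition (K : countType) (U : T -> K) (f g : T -> \bar R) :
  discrete_fun U -> measurable_fun [set: T] f -> measurable_fun [set: T] g ->
  (forall w, 0 <= f w) -> (forall w, 0 <= g w) ->
  (forall u, \int[P]_(w in [set w | U w = u]) f w =
             \int[P]_(w in [set w | U w = u]) g w) ->
  \int[P]_w f w = \int[P]_w g w.
Proof.
move=> dU mf mg f0 g0 fg.
pose A (i : nat) := [set w | pickle (U w) = i].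
have mA i : measurable (A i) by exact: (dU [set u | pickle u = i]).
have AT : \bigcup_i A i = setT.
  by apply/seteqP; split => // w _; exists (pickle (U w)).
have tA : trivIset setT A by move=> i j _ _ [w [/= <- <-]].
rewrite -AT !ge0_integral_bigcup ?AT//.
apply: eq_eseriesr => i _.
have [[w0 <-]|nA] := pselect (exists w, pickle (U w) = i).
  rewrite (_ : A _ = [set w | U w = U w0])//.
  apply/seteqP; split => w /=; last by rewrite /A /= => ->.
  by move=> /(pcan_inj pickleK).
rewrite (_ : A i = set0) ?integral_set0//.
by apply/seteqP; split => // w /= Uw; apply: nA; exists w.
Qed.

Lemma integral_discrete_nat (M : T -> nat) (h : nat -> R) :
  discrete_fun M -> (forall c, 0 <= h c)%R ->
  \int[P]_w (h (M w))%:E = \sum_(c <oo) (h c)%:E * P [set w | M w = c].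
Proof.
move=> dM h0; pose A (i : nat) := [set w | M w = i].
have mA i : measurable (A i) by exact: (dM [set i]).
have AT : \bigcup_i A i = setT by apply/seteqP; split => // w _; exists (M w).
have tA : trivIset setT A by move=> i j _ _ [w [/= <- <-]].
rewrite -AT ge0_integral_bigcup ?AT//; last 2 first.
- apply/measurable_EFinP/discrete_measurable; exact: (discrete_comp h dM).
- by move=> w _; rewrite lee_fin.
apply: eq_eseriesr => i _.
rewrite (eq_integral (fun=> (h i)%:E)); last by move=> w; rewrite inE /A /= => ->.
by rewrite integral_cst.
Qed.

Lemma integral_null_set (G : set T) (f : T -> \bar R) : measurable G ->
  P G = 0 -> measurable_fun [set: T] f -> (forall w, 0 <= f w) ->
  \int[P]_(w in G) f w = 0.
Proof.
move=> mG G0 mf f0; rewrite (ge0_negligible_integral mG)// ?setDv ?integral_set0//.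
exact: measurable_funTS.
Qed.

End CountablePartition.

(** * From random keys to the number of keys in an interval *)

Section ModelExpectation.
Local Open Scope ereal_scope.
Context {R : realType} (f : R -> R) (lambda : R) d (T : measurableType d)
  (P : probability T R) (X : nat -> {RV P >-> R}) (N : {RV P >-> nat})
  (pivot : seq bool -> nat -> {RV P >-> nat}).
Hypothesis model : quicksort_model f lambda X N pivot.
Variable I : pred R.
Hypothesis cI : convex_pred I.
Hypothesis mI : measurable [set x | I x].

Definition keys n (w : T) : seq R := mkseq (fun i => X i w) n.

Lemma keysE n w : keys n w = mkseq (key_at X n w) n.
Proof.
by apply/eq_in_map => i; rewrite mem_iota /key_at /= => ->.
Qed.

Lemma key_at_default n w : key_at X n w n = 0%R.
Proof. by rewrite /key_at ltnn. Qed.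

Definition comparisons (w : T) : seq (R * R) :=
  quicksort_comparisons (fun v n => pivot v n w) (N w) [::] (keys (N w) w).

Lemma comparisonsE n w : N w = n ->
  cmp_in I (comparisons w) = pattern_cmp_in (member_pattern I (key_at X n w) n)
    (qs_idx (pattern_lt (order_pattern (key_at X n w) n)) n
       (fun v n => pivot v n w) n [::] (iota 0 n)).
Proof.
by move=> Nw; rewrite /comparisons Nw keysE cmp_in_pattern// key_at_default.
Qed.

Lemma discrete_cmp_comparisons : discrete_fun (fun w => cmp_in I (comparisons w)).
Proof.
rewrite (_ : (fun w => _) = (fun w => let n := N w in
   pattern_cmp_in (member_pattern I (key_at X n w) n)
    (qs_idx (pattern_lt (order_pattern (key_at X n w) n)) n
       (fun v n => pivot v n w) n [::] (iota 0 n)))); last first.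
  by apply/funext => w; rewrite (comparisonsE (n := N w)).
apply: (discrete_bind (F := N) (G := fun n w => pattern_cmp_in (member_pattern I (key_at X n w) n)
    (qs_idx (pattern_lt (order_pattern (key_at X n w) n)) n
       (fun v n => pivot v n w) n [::] (iota 0 n)))); first exact: RV_discrete.
move=> n.
apply: (discrete_bind (F := fun w => pattern I (key_at X n w) n)
  (G := fun p w => pattern_cmp_in p.2
    (qs_idx (pattern_lt p.1) n (fun v n => pivot v n w) n [::] (iota 0 n)))).
  apply: discrete_pattern => // i; exact: measurable_key_at.
move=> p; apply: (discrete_comp (pattern_cmp_in p.2)).
by apply: discrete_qs_idx => v k; exact: RV_discrete.
Qed.

Definition key_count (n : nat) (w : T) : nat := count I (keys n w).

Lemma discrete_key_count n : discrete_fun (key_count n).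
Proof.
rewrite (_ : key_count n = (fun w => count (nth false (member_pattern I (key_at X n w) n)) (iota 0 n))); last first.
  by apply/funext => w; rewrite /key_count keysE count_pattern.
apply: (discrete_comp (fun p => count (nth false p.2) (iota 0 n))
   (F := fun w => pattern I (key_at X n w) n)).
apply: discrete_pattern => // i; exact: measurable_key_at.
Qed.

Lemma discrete_key_countN : discrete_fun (fun w => key_count (N w) w).
Proof.
apply: (discrete_bind (F := N) (G := key_count)); first exact: RV_discrete.
exact: discrete_key_count.
Qed.

(** On each event fixing N and the pattern, the keys are replaced by those of one sample point w0.
    It is taken outside N0, so that its keys are distinct; if there is none, the event is null and
    both integrals vanish. *)
Lemma mean_cmp_model (N0 : set T) : P N0 = 0 -> measurable N0 ->
  (forall w, ~ N0 w -> injective (fun i => X i w)) ->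
  \int[P]_w (cmp_in I (comparisons w))%:R%:E =
  \int[P]_w (qs_mean (key_count (N w) w))%:E.
Proof.
move=> PN0 mN0 injX.
pose U w := (N w, pattern I (key_at X (N w) w) (N w)).
have dU : discrete_fun U.
  apply: (discrete_bind (F := N) (G := fun n w => (n, pattern I (key_at X n w) n))).
    exact: RV_discrete.
  move=> n; apply: (discrete_comp (fun p => (n, p))).
  apply: discrete_pattern => // i; exact: measurable_key_at.
have mZ : measurable_fun [set: T] (fun w => (cmp_in I (comparisons w))%:R%:E : \bar R).
  apply/measurable_EFinP/discrete_measurable.
  exact: (discrete_comp (fun n : nat => n%:R : R) discrete_cmp_comparisons).
have mC : measurable_fun [set: T] (fun w => (qs_mean (key_count (N w) w))%:E : \bar R).
  apply/measurable_EFinP/discrete_measurable.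
  exact: (discrete_comp (fun n : nat => qs_mean n : R) discrete_key_countN).
apply: (eq_integral_partition dU) => //.
  by move=> w; rewrite lee_fin qs_mean_ge0.
move=> [n u].
have mU : measurable [set w | U w = (n, u)] by exact: (dU [set (n, u)]).
have [[w0 [Uw0 nN0]]|nex] := pselect (exists w, U w = (n, u) /\ ~ N0 w); last first.
  have PU : P [set w | U w = (n, u)] = 0.
    apply: (subset_measure0 _ _ _ PN0) => // w Uw; apply: contrapT => nw.
    by apply: nex; exists w.
  by rewrite !integral_null_set// => w; rewrite lee_fin qs_mean_ge0.
have UE : [set w | U w = (n, u)] =
    [set w | N w = n] `&` [set w | pattern I (key_at X n w) n = u].
  apply/seteqP; split => w; rewrite /U /=; first by move=> [-> <-].
  by move=> [-> ->].
have [Nw0 uw0] : N w0 = n /\ pattern I (key_at X n w0) n = u.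
  by move: Uw0; rewrite /U => -[-> <-].
rewrite (eq_integral (fun w => (cmp_in I (quicksort_comparisons
   (fun v n => pivot v n w) n [::] (keys n w0)))%:R%:E)); last first.
  move=> w; rewrite UE inE => -[/= Nw uw]; rewrite (comparisonsE Nw).
  rewrite keysE cmp_in_pattern ?key_at_default//.
  have /= -> := congr1 fst (etrans uw (esym uw0)).
  by have /= -> := congr1 snd (etrans uw (esym uw0)).
rewrite [RHS](eq_integral (fun w => (qs_mean (count I (keys n w0)))%:E)); last first.
  move=> w; rewrite UE inE => -[/= -> uw]; rewrite /key_count !keysE !count_pattern.
  by have /= -> := congr1 snd (etrans uw (esym uw0)).
rewrite integral_cst// {1}UE mean_cmp_in ?UE//.
- by move=> v k; exact: RV_discrete.
- by move=> v m k km; rewrite (pivot_uniform model).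
- by rewrite map_inj_uniq ?iota_uniq//; exact: injX.
- by rewrite size_mkseq.
- exact: (pattern_pivot_indep model).
Qed.

Variable p : R.
Hypothesis XI : forall i, P (X i @^-1` [set x | I x]) = p%:E.

Lemma prob_keys_in_01 : (0 <= p <= 1)%R.
Proof.
by rewrite -!lee_fin -(XI 0) measure_ge0 /= probability_le1//; exact: RV_measurable.
Qed.

Definition key_event (l : seq nat) (B : nat -> set R) : set T :=
  \big[setI/setT]_(j <- l) (X j @^-1` B j).

Lemma key_event_prob l B : uniq l -> (forall j, measurable (B j)) ->
  P (key_event l B) = \prod_(j <- l) P (X j @^-1` B j).
Proof.
move=> ul mB.
have := model_independent model (s := [seq inl (inl j) | j <- l])
  (E := fun i => if i is inl (inl j) then X j @^-1` B j else setT).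
rewrite !big_map /=; apply; first by rewrite map_inj_uniq// => i j [].
by move=> _ /mapP[j _ ->]; exact: generated_by_preimage.
Qed.

(** The conditions B on the keys of index at least n generalize the induction: the step from n to n
    + 1 splits on whether key n lies in I and moves that condition into l. *)
Lemma key_count_binomial n c l B : uniq l -> all (leq n) l ->
  (forall j, measurable (B j)) ->
  P ([set w | key_count n w = c] `&` key_event l B) =
  ('C(n, c)%:R * p ^+ c * (1 - p) ^+ (n - c))%:E * P (key_event l B).
Proof.
elim: n c l B => [|n IH] c l B ul nl mB.
  case: c => [|c].
    by rewrite bin0 !expr0 !mul1r mul1e (_ : [set w | _] = setT) ?setTI//; apply/seteqP.
  rewrite bin0n /= !mul0r mul0e (_ : [set w | _] = set0) ?set0I ?measure0//.
  by apply/seteqP; split.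
have mE l' B' : (forall j, measurable (B' j)) -> measurable (key_event l' B').
  by move=> mB'; apply: bigsetI_measurable => j _; exact: RV_measurable.
pose BI (J : set R) := fun j => if j == n then J else B j.
have mBI J : measurable J -> forall j, measurable (BI J j).
  by move=> mJ j; rewrite /BI; case: ifP.
have nnl : n \notin l by apply/negP => /(allP nl); rewrite ltnn.
have BIl J : {in l, forall j, BI J j = B j}.
  by move=> j jl; rewrite /BI; case: eqP => // jn; rewrite -jn jl in nnl.
have EI J : key_event (n :: l) (BI J) = X n @^-1` J `&` key_event l B.
  rewrite /key_event big_cons {1}/BI eqxx; congr (_ `&` _).
  by apply: eq_big_seq => j jl; rewrite BIl.
have PI J : measurable J ->
    P (key_event (n :: l) (BI J)) = P (X n @^-1` J) * P (key_event l B).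
  move=> mJ; rewrite !key_event_prob//= ?nnl//; last exact: mBI.
  rewrite big_cons {1}/BI eqxx; congr (_ * _).
  by apply: eq_big_seq => j jl; rewrite BIl.
have nl' : all (leq n) (n :: l).
  by rewrite /= leqnn; apply: sub_all nl => j /ltnW.
have ul' : uniq (n :: l) by rewrite /= nnl.
have kS w : key_count n.+1 w = (key_count n w + I (X n w))%N.
  by rewrite /key_count /keys /mkseq -[n.+1]addn1 iotaD map_cat count_cat /= addn0.
have mk a m : measurable [set w | key_count m w = a] by exact: (discrete_key_count m [set a]).
pose J1 := [set x | I x]; pose J0 := ~` J1.
have mJ0 : measurable J0 by exact: measurableC.
have PJ0 : P (X n @^-1` J0) = (1 - p)%:E.
  rewrite /J0 preimage_setC probability_setC; last exact: (RV_measurable (X n) mI).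
  by rewrite XI.
have split0 a : [set w | key_count n w = a] `&` key_event (n :: l) (BI J0) =
    [set w | key_count n w = a /\ ~~ I (X n w)] `&` key_event l B.
  rewrite EI setIA; congr (_ `&` _); apply/seteqP; split => w /= [-> h]; split=> //.
    exact/negP.
  exact/negP.
have split1 a : [set w | key_count n w = a] `&` key_event (n :: l) (BI J1) =
    [set w | key_count n w = a /\ I (X n w)] `&` key_event l B.
  by rewrite EI setIA; congr (_ `&` _); apply/seteqP.
have Pfin : P (key_event l B) \is a fin_num by apply: fin_num_measure; exact: mE.
case: c => [|c].
  rewrite (_ : _ `&` _ = [set w | key_count n w = 0%N] `&` key_event (n :: l) (BI J0)); last first.
    rewrite split0; congr (_ `&` _); apply/seteqP; split => w /=; rewrite kS.
      by move=> /eqP; rewrite addn_eq0 => /andP[/eqP -> ]; case: (I _).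
    by move=> [-> /negPf ->].
  rewrite IH//; last exact: mBI.
  rewrite PI// PJ0 !bin0 !expr0 !mul1r !subn0 muleA -EFinM; congr (_%:E * _).
  by rewrite exprSr.
rewrite (_ : _ `&` _ = ([set w | key_count n w = c.+1] `&` key_event (n :: l) (BI J0)) `|`
   ([set w | key_count n w = c] `&` key_event (n :: l) (BI J1))); last first.
  rewrite split0 split1 -setIUl; congr (_ `&` _).
  apply/seteqP; split => w /=; rewrite kS.
    case: (I _); rewrite ?addn1 ?addn0; first by move=> [->]; right.
    by move=> ->; left.
  by case=> -[-> ]; [move=> /negPf ->; rewrite addn0|move=> ->; rewrite addn1].
set A0 := _ `&` key_event _ (BI J0); set A1 := _ `&` key_event _ (BI J1).
have mA0 : measurable A0 by apply: measurableI => //; apply: mE; exact: mBI.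
have mA1 : measurable A1 by apply: measurableI => //; apply: mE; exact: mBI.
have dA : A0 `&` A1 = set0.
  rewrite /A0 /A1 split0 split1; apply/seteqP; split => // w /= [[[-> _] _] [[/eqP]]].
  by rewrite eqn_leq ltnn.
have -> : P (A0 `|` A1) = P A0 + P A1 by exact: measureU.
rewrite /A0 /A1.
rewrite !IH//; [|exact: mBI..].
rewrite !PI// PJ0 XI -(fineK Pfin) -!EFinM -EFinD !mulrA -mulrDl; congr (_ * _)%:E.
rewrite subSS binS natrD; have [cn|nc] := ltnP c n.
  by rewrite -(subnSK cn) !exprS; ring.
have -> : (n - c = 0)%N by apply/eqP.
by rewrite (@bin_small n c.+1)// !exprS; ring.
Qed.

Lemma key_count_prob m n c :
  P ([set w | key_count n w = c] `&` [set w | N w = m]) =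
  ('C(n, c)%:R * p ^+ c * (1 - p) ^+ (n - c) * poisson_pmf lambda m)%:E.
Proof.
have sE : <<s rects X n >> [set w | key_count n w = c].
  rewrite (_ : [set w | _] = [set w | [set c] (count (nth false (pattern I (key_at X n w) n).2) (iota 0 n))]).
    exact: (@rects_discrete_pattern _ _ _ _ _ I n _ (fun q => count (nth false q.2) (iota 0 n)) [set c] mI).
  by apply/seteqP; split => w /=; rewrite /key_count keysE count_pattern.
have := @rects_indep _ _ _ _ _ _ _ _ _ model n m [::] (fun=> 0%N) _ isT sE.
rewrite /pivot_event !big_nil setIT mule1 => ->; rewrite (number_poisson model).
have := @key_count_binomial n c [::] (fun=> setT) isT isT.
by rewrite /key_event big_nil setIT probability_setT mule1 => ->.
Qed.

End ModelExpectation.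

(** * Poisson means and thinning *)

Section Poisson.
Context {R : realType}.
Implicit Types (s a b : R) (h g : nat -> R).

Lemma eseries_cvg_series (u : nat -> R) a : (forall n, 0 <= u n) ->
  series u @ \oo --> a -> (\sum_(n <oo) (u n)%:E = a%:E)%E.
Proof.
move=> u0 ua; rewrite -(cvg_lim _ ua)// -EFin_lim; last by apply/cvg_ex; exists a.
by apply: congr_lim; apply/funext => n /=; rewrite /series /= sumEFin.
Qed.

(** The formula is kept for every real s; an interval without mass gives s = 0. *)
Definition pois s (n : nat) : R := s ^+ n / n`!%:R * expR (- s).

Lemma pois_ge0 s n : 0 <= s -> 0 <= pois s n.
Proof. by move=> s0; rewrite mulr_ge0 ?expR_ge0// divr_ge0// exprn_ge0. Qed.

(* The mean of h N is a, for N Poisson of mean s. *)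
Variant pois_mean s h a : Prop :=
  PoisMean of series (fun n => pois s n * h n) @ \oo --> a.

Lemma pois_mean1 s : pois_mean s (fun=> 1) 1.
Proof.
split.
suff : series (fun n => pois s n * 1) @ \oo --> expR s * expR (- s).
  by rewrite -expRD subrr expR0.
rewrite (_ : series _ = fun n => series (exp_coeff s) n * expR (- s)); last first.
  apply/funext => n; rewrite /series /= mulr_suml; apply: eq_bigr => i _.
  by rewrite mulr1.
by apply: cvgMl; exact: is_cvg_series_exp_coeff.
Qed.

Lemma pois_meanD s h g a b : pois_mean s h a -> pois_mean s g b ->
  pois_mean s (fun n => h n + g n) (a + b).
Proof.
move=> [ha] [gb]; split; rewrite (_ : series _ = series (fun n => pois s n * h n) \+ series (fun n => pois s n * g n)).
  exact: cvgD.
apply/funext => n; rewrite /series /= -big_split; apply: eq_bigr => i _.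
by rewrite mulrDr.
Qed.

Lemma pois_meanZ s h a b : pois_mean s h a -> pois_mean s (fun n => b * h n) (b * a).
Proof.
move=> [ha]; split; rewrite (_ : series _ = fun n => b * series (fun n => pois s n * h n) n).
  exact: cvgMr.
apply/funext => n; rewrite /series /= mulr_sumr; apply: eq_bigr => i _.
by rewrite mulrCA.
Qed.

Lemma eq_pois_mean s h g a : h =1 g -> pois_mean s h a -> pois_mean s g a.
Proof. by move=> /funext ->. Qed.

(* E[N h(N)] = s E[h(N + 1)] *)
Lemma pois_mean_shift s h a : pois_mean s (fun n => h n.+1) a ->
  pois_mean s (fun n => n%:R * h n) (s * a).
Proof.
move=> [ha]; split; rewrite -cvg_shiftS /=.
rewrite (_ : (fun n => _) = fun n => s * series (fun n => pois s n * h n.+1) n).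
  exact: cvgMr.
apply/funext => n; rewrite /series /= big_nat_recl// mul0r mulr0 add0r mulr_sumr.
apply: eq_bigr => i _; rewrite /pois exprS factS natrM invfM.
have : i.+1%:R != 0 :> R by rewrite pnatr_eq0.
have : i`!%:R != 0 :> R by rewrite pnatr_eq0 -lt0n fact_gt0.
by move=> h1 h2; field; rewrite h1 addrC natr1 h2.
Qed.

Lemma pois_mean_id s : pois_mean s (fun n => n%:R) s.
Proof.
have := pois_mean_shift (h := fun=> 1) (pois_mean1 s).
by rewrite mulr1; refine (eq_pois_mean _) => n; rewrite mulr1.
Qed.

Lemma pois_mean_falling s : pois_mean s (fun n => n%:R * (n%:R - 1)) (s * s).
Proof.
apply: (pois_mean_shift (h := fun n => n%:R - 1)).
by refine (eq_pois_mean _ (pois_mean_id s)) => n; rewrite -natr1 addrK.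
Qed.

Lemma le_pois_mean s h g a b : 0 <= s -> (forall n, h n <= g n) ->
  pois_mean s h a -> pois_mean s g b -> a <= b.
Proof.
move=> s0 hg [ha] [gb]; apply: ler_cvg_to ha gb _; apply: nearW => n.
by apply: ler_sum => i _; rewrite ler_wpM2l// pois_ge0.
Qed.

Lemma pois_mean_dominated s h g b : 0 <= s ->
  (forall n, 0 <= h n <= g n) -> pois_mean s g b -> exists a, pois_mean s h a.
Proof.
move=> s0 hg [gb].
suff /cvg_ex[a ha] : cvgn (series (fun n => pois s n * h n)) by exists a.
apply: series_le_cvg (cvgP _ gb).
- by move=> n; rewrite mulr_ge0 ?pois_ge0//; case/andP: (hg n).
- by move=> n; rewrite mulr_ge0 ?pois_ge0//; case/andP: (hg n) => /le_trans; apply.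
- by move=> n; rewrite ler_wpM2l ?pois_ge0//; case/andP: (hg n).
Qed.

(** The weight at c of the Poisson law of mean lambda p factors out; what remains is the total mass
    of the Poisson law of mean lambda (1 - p), counting the keys that fall elsewhere. *)
Lemma thinning lambda p c : 0 < lambda ->
  series (fun m => 'C(m, c)%:R * p ^+ c * (1 - p) ^+ (m - c) * poisson_pmf lambda m)
    @ \oo --> pois (lambda * p) c.
Proof.
(* The terms with m < c vanish, so the series is read from index c on. *)
move=> l0; rewrite -(cvg_shiftn c) /=.
rewrite (_ : (fun n => _) = fun n => pois (lambda * p) c * series (fun i => pois (lambda * (1 - p)) i * 1) n).
  suff : pois (lambda * p) c * series (fun i => pois (lambda * (1 - p)) i * 1) n @[n --> \oo]
      --> pois (lambda * p) c * 1 by rewrite [pois _ c * 1]mulr1.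
  by apply: cvgMr; case: (pois_mean1 (lambda * (1 - p))).
apply/funext => n; rewrite /series /= (@big_cat_nat _ _ _ c)//= ?leq_addl//.
rewrite big_nat big1 ?add0r; last first.
  by move=> i /andP[_ ic]; rewrite bin_small// !mul0r.
rewrite -{1}[c]add0n big_addn addnK mulr_sumr; apply: eq_bigr => i _.
rewrite addnK /poisson_pmf l0 /pois mulr1.
have -> : expR (- lambda) = expR (- (lambda * p)) * expR (- (lambda * (1 - p))).
  by rewrite -expRD; congr expR; ring.
have := bin_fact (leq_addl i c); rewrite addnK => <-.
rewrite !natrM exprD !exprMn.
have : i`!%:R != 0 :> R by rewrite pnatr_eq0 -lt0n fact_gt0.
have : c`!%:R != 0 :> R by rewrite pnatr_eq0 -lt0n fact_gt0.
have : 'C(i + c, c)%:R != 0 :> R by rewrite pnatr_eq0 -lt0n bin_gt0 leq_addl.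
by move=> h1 h2 h3; field; rewrite h1 h2 h3.
Qed.

Definition qs_poisson s : R := limn (series (fun n => pois s n * qs_mean n)).

Lemma qs_poissonP s : 0 <= s -> pois_mean s qs_mean (qs_poisson s).
Proof.
move=> s0; suff [a [ha]] : exists a, pois_mean s qs_mean a.
  by split; rewrite /qs_poisson (cvg_lim _ ha).
refine (pois_mean_dominated s0 _ (pois_mean_falling s)) => n.
by rewrite qs_mean_ge0 qs_mean_le.
Qed.

Lemma qs_poisson_ge0 s : 0 <= s -> 0 <= qs_poisson s.
Proof.
move=> s0; have := pois_meanZ 0 (pois_mean1 s); rewrite mul0r => h0.
refine (le_pois_mean s0 _ h0 (qs_poissonP s0)) => n.
by rewrite ?mul0r qs_mean_ge0.
Qed.

Lemma qs_poisson_le_sqr s : 0 <= s -> qs_poisson s <= s * s.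
Proof.
move=> s0; refine (le_pois_mean s0 _ (qs_poissonP s0) (pois_mean_falling s)) => n.
exact: qs_mean_le.
Qed.

(** Tangents at s give both bounds: n ln n >= (ln s + 1) n - s by convexity, and ln n <= ln s + n /
    s - 1, multiplied by n. Their Poisson means are s ln s and s ln s + 1. *)
Lemma pois_mean_nlnn s : 0 < s -> exists e,
  pois_mean s (fun n => n%:R * ln n%:R) e /\ s * ln s <= e <= s * ln s + 1.
Proof.
move=> s0.
have sq : pois_mean s (fun n => n%:R * (n%:R - 1) + n%:R) (s * s + s).
  by apply: pois_meanD; [exact: pois_mean_falling|exact: pois_mean_id].
have [e he] : exists e, pois_mean s (fun n => n%:R * ln n%:R) e.
  refine (pois_mean_dominated (ltW s0) _ sq) => -[|n].
    by rewrite !mul0r addr0 lexx.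
  rewrite mulr_ge0//= ?ln_ge0 ?ler1n//.
  rewrite -[X in _ <= _ + X]mulr1 -mulrDr subrK ler_wpM2l//.
  have := @le_ln1Dx R n%:R; rewrite nat1r => /(_ _)/le_trans; apply; last by rewrite ler_nat.
  exact: lt_le_trans (ltrN10 _) _.
exists e; split=> //; apply/andP; split.
  have lo : pois_mean s (fun n => (ln s + 1) * n%:R + (- s) * 1) ((ln s + 1) * s + (- s) * 1).
    by apply: pois_meanD; apply: pois_meanZ; [exact: pois_mean_id|exact: pois_mean1].
  have := le_pois_mean (ltW s0) _ lo he.
  rewrite (_ : (ln s + 1) * s + - s * 1 = s * ln s); last by ring.
  apply=> -[|n]; first by rewrite mulr0 mul0r add0r mulr1 oppr_le0 ltW.
  have n0 : 0 < n.+1%:R :> R by [].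
  have := @le_ln1Dx R (s / n.+1%:R - 1).
  rewrite addrCA subrr addr0 ltrBrDr addNr divr_gt0// => /(_ isT).
  rewrite ln_div ?posrE// lerBrDr -subr_ge0 -(pmulr_lge0 _ n0).
  rewrite (_ : (_ - _) * _ = n.+1%:R * ln n.+1%:R - ((ln s + 1) * n.+1%:R - s)); last first.
    by field; rewrite gt_eqF.
  by rewrite subr_ge0 mulr1.
have up : pois_mean s (fun n => (ln s - 1) * n%:R + s^-1 * (n%:R * (n%:R - 1) + n%:R))
   ((ln s - 1) * s + s^-1 * (s * s + s)).
  by apply: pois_meanD; apply: pois_meanZ; [exact: pois_mean_id|exact: sq].
have := le_pois_mean (ltW s0) _ he up.
rewrite (_ : (ln s - 1) * s + s^-1 * (s * s + s) = s * ln s + 1); last first.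
  by field; rewrite gt_eqF.
apply=> -[|n]; first by rewrite !(mul0r, mulr0, addr0).
have n0 : 0 < n.+1%:R :> R by [].
have := @le_ln1Dx R (n.+1%:R / s - 1).
rewrite addrCA subrr addr0 ltrBrDr addNr divr_gt0// => /(_ isT).
rewrite ln_div ?posrE// lerBrDr -subr_ge0 -(pmulr_lge0 _ n0).
rewrite (_ : (_ - _) * _ = (ln s - 1) * n.+1%:R + s^-1 * (n.+1%:R * (n.+1%:R - 1) + n.+1%:R) - n.+1%:R * ln n.+1%:R); last first.
  by field; rewrite gt_eqF.
by rewrite subr_ge0.
Qed.

End Poisson.

(** * Asymptotics and bounds for the mean cost *)

Section Asymptotics.
Context {R : realType}.
Implicit Types (s x c : R).

Lemma qs_meanE n : qs_mean n = 2 * n.+1%:R * series harmonic n - 4 * n%:R :> R.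
Proof.
elim: n => [|n IH]; first by rewrite /series /= big_geq// mulr0 mulr0 subrr.
have n0 : n.+1%:R != 0 :> R by rewrite pnatr_eq0.
apply: (mulIf n0); rewrite qs_meanS IH seriesS /harmonic /=.
rewrite -[n.+2%:R]natr1; move: n0; rewrite -[n.+1%:R]natr1 => n0.
by field.
Qed.

(** The limit is Euler's constant. The sequence decreases and is nonnegative, both by ln (1 + x) <=
    x. *)
Lemma harmonic_ln_cvg : cvgn (fun n => series harmonic n.+1 - ln n.+1%:R : R).
Proof.
have lnS n : n.+2%:R^-1 <= ln n.+2%:R - ln n.+1%:R :> R.
  have h : n.+1%:R / n.+2%:R = 1 - n.+2%:R^-1 :> R.
    have : n.+2%:R != 0 :> R by rewrite pnatr_eq0.
    by rewrite -[n.+2%:R]natr1 => h; field.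
  have := @le_ln1Dx R (- n.+2%:R^-1).
  rewrite -h ltrN2 invf_lt1// ltr1n => /(_ isT).
  by rewrite ln_div ?posrE// lerNr opprB.
apply: nonincreasing_is_cvgn.
  apply/nonincreasing_seqP => n.
  have E : series harmonic n.+2 = n.+2%:R^-1 + series harmonic n.+1 :> R.
    by rewrite [LHS]seriesS.
  rewrite E; have := lnS n.
  by move: (ln _) (ln _) (_^-1) (series _ _) => a b c d; lra.
exists 0 => _ [n _ <-]; rewrite subr_ge0.
have : ln n.+1%:R <= series harmonic n :> R.
  elim: n => [|n IH]; first by rewrite ln1 /series /= big_geq.
  have h : n.+2%:R / n.+1%:R = 1 + n.+1%:R^-1 :> R.
    have : n.+1%:R != 0 :> R by rewrite pnatr_eq0.
    by rewrite -[n.+2%:R]natr1 => h; field.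
  have := @le_ln1Dx R n.+1%:R^-1; rewrite -h ln_div ?posrE//.
  rewrite (lt_trans (ltrN10 _)) ?invr_gt0// => /(_ isT).
  have E : series harmonic n.+1 = n.+1%:R^-1 + series harmonic n :> R.
    by rewrite [LHS]seriesS.
  by rewrite E; move: (ln _) (ln _) (_^-1) (series _ _) IH => a b c d; lra.
by move=> /le_trans; apply; rewrite seriesS /= lerDr invr_ge0.
Qed.

Lemma qs_mean_asymp : exists c, forall th : R, 0 < th ->
  exists2 A, 0 <= A & forall n,
    `|qs_mean n - n%:R * (2 * ln n%:R + c)| <= th * n%:R + A.
Proof.
have /cvg_ex[g hg] := harmonic_ln_cvg.
pose w n : R := qs_mean n.+1 / n.+1%:R - 2 * ln n.+1%:R.
(* By the closed form, w is 2 (H - ln) - 4 plus twice the average of the first n + 1 terms of the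
   harmonic sequence, which tends to 0 by Cesaro. *)
have wg : w @ \oo --> 2 * g - 4 + 2 * 0.
  rewrite (_ : w = fun n => 2 * (series harmonic n.+1 - ln n.+1%:R) - 4
     + 2 * arithmetic_mean harmonic n).
    apply: cvgD; first by apply: cvgB; [apply: cvgMr|exact: cvg_cst].
    by apply: cvgMr; apply: cesaro; exact: cvg_harmonic.
  apply/funext => n; rewrite /w qs_meanE /arithmetic_mean /= -[n.+2%:R]natr1.
  have : n.+1%:R != 0 :> R by rewrite pnatr_eq0.
  by move=> h; field.
exists (2 * g - 4) => th th0.
move: wg; rewrite mulr0 addr0 => /cvgrPdist_le/(_ _ th0)[n0 _ wn0].
pose A : R := \sum_(i < n0.+1) `|qs_mean i - i%:R * (2 * ln i%:R + (2 * g - 4))|.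
have A0 : 0 <= A by apply: sumr_ge0.
exists A => // n; have [nn0|n0n] := leqP n n0.
  rewrite /A (bigD1 (Ordinal (nn0 : (n < n0.+1)%N)))//=.
  have h1 : 0 <= th * n%:R by rewrite mulr_ge0// ltW.
  by rewrite [leRHS]addrCA lerDl addr_ge0// sumr_ge0.
case: n n0n => // n n0n; apply: (@le_trans _ _ (th * n.+1%:R)); last by rewrite lerDl.
rewrite -ler_pdivrMr// -[X in _ / X]gtr0_norm// -normfV -normrM.
have := wn0 n n0n; rewrite distrC; apply: le_trans; rewrite le_eqVlt; apply/orP; left; apply/eqP.
have : n.+1%:R != 0 :> R by rewrite pnatr_eq0.
by move=> h; congr `| _ |; rewrite /w; field.
Qed.

Lemma qs_poisson_asymp : exists c, forall th : R, 0 < th ->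
  exists2 A, 0 <= A & forall s, 0 <= s ->
    `|qs_poisson s - s * (2 * ln s + c)| <= th * s + A.
Proof.
have [c hc] := qs_mean_asymp; exists c => th th0.
(* The extra 2 is twice the gap 1 between the bounds of [pois_mean_nlnn]. *)
have [A A0 hA] := hc th th0; exists (A + 2); first by rewrite addr_ge0.
move=> s; rewrite le_eqVlt => /predU1P[<-|s0].
  rewrite mul0r subr0 mulr0 add0r ger0_norm ?qs_poisson_ge0//.
  by rewrite (le_trans (qs_poisson_le_sqr (lexx _)))// mulr0 addr_ge0.
have [e [he /andP[e1 e2]]] := pois_mean_nlnn s0.
have Q := qs_poissonP (ltW s0).
have aff a b : pois_mean s (fun n => 2 * (n%:R * ln n%:R) + (a * n%:R + b * 1)) (2 * e + (a * s + b * 1)).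
  apply: pois_meanD; first exact: pois_meanZ.
  by apply: pois_meanD; apply: pois_meanZ; [exact: pois_mean_id|exact: pois_mean1].
have up := le_pois_mean (ltW s0) _ Q (aff (c + th) A).
have lo := le_pois_mean (ltW s0) _ (aff (c - th) (- A)) Q.
rewrite ler_norml; apply/andP; split.
- have {}lo : 2 * e + ((c - th) * s + - A * 1) <= qs_poisson s.
    by apply: lo => n; have := hA n; rewrite ler_norml => /andP[+ _]; lra.
  by lra.
- have {}up : qs_poisson s <= 2 * e + ((c + th) * s + A * 1).
    by apply: up => n; have := hA n; rewrite ler_norml => /andP[_ +]; lra.
  by lra.
Qed.

Lemma lnp_ge0 x : 0 <= lnp x.
Proof. by rewrite /lnp le_max lexx orbT. Qed.

Lemma le_lnp x y : x <= y -> lnp x <= lnp y.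
Proof.
move=> xy; have [x0|x0] := leP x 0; first by rewrite {1}/lnp ln0// maxxx lnp_ge0.
by rewrite /lnp ge_max !le_max lexx !orbT andbT ler_ln ?posrE ?xy// (lt_le_trans x0).
Qed.

(** For s <= 1, or where s is the minimum, G(s) <= s^2 suffices. For s > 1 the asymptotic estimate
    with theta = 1 gives 2 ln s + |c| + 1 + A per unit of s. *)
Lemma qs_poisson_le : exists2 B : R, 0 < B & forall s, 0 <= s ->
  qs_poisson s <= B * s * Num.min s (1 + lnp s).
Proof.
have [c /(_ 1 ltr01)[A A0 hA]] := qs_poisson_asymp.
have c0 := normr_ge0 c.
have B0 : 0 < 3 + `|c| + A by lra.
exists (3 + `|c| + A) => // s s0; have q2 := qs_poisson_le_sqr s0.
have l0 := lnp_ge0 s.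
have sl0 : 0 <= s * lnp s by rewrite mulr_ge0.
have ss0 : 0 <= s * s by rewrite mulr_ge0.
rewrite /Num.min; case: ltP => _.
  apply: (le_trans q2); rewrite -mulrA ler_peMl//; lra.
have [s1|s1] := leP s 1.
  have ss : s * s <= s by rewrite ler_piMr.
  have : 0 <= (2 + `|c| + A) * s by rewrite mulr_ge0//; lra.
  have : 0 <= (3 + `|c| + A) * (s * lnp s) by rewrite mulr_ge0//; lra.
  lra.
have := hA s s0; rewrite ler_norml => /andP[_ h].
have hl : s * ln s <= s * lnp s by rewrite ler_wpM2l// /lnp le_max lexx.
have hc : s * c <= s * `|c| by rewrite ler_wpM2l// ler_norm.
have hA' : A <= A * s by rewrite ler_peMr// ltW.
have : 0 <= (1 + `|c| + A) * (s * lnp s) by rewrite mulr_ge0//; lra.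
lra.
Qed.

Lemma ln2_bounds : 2^-1 <= (ln 2 : R) <= 1.
Proof.
apply/andP; split.
  have := @le_ln1Dx R (- 2^-1); rewrite (_ : 1 - 2^-1 = 2^-1); last by lra.
  by rewrite lnV ?posrE// lerN2; apply; lra.
by have := @le_ln1Dx R 1; apply; lra.
Qed.

(* Pieces with small density make s = 2^(1-j) x small; on the others the
   fourth power of the logarithm beats (1 + j)^2 (1 + ln x). *)
Lemma dyadic_tail_le : exists2 C : R, 0 < C & forall (j : nat) x, 0 <= x ->
  Num.min (2 / 2 ^+ j * x) (1 + lnp (2 * x)) <=
  C * (1 + lnp (x / 2) ^+ 4) / (1 + j%:R) ^+ 2.
Proof.
(* 1024 = 64 (3 + 7 + 5 + 1), from the coefficients of (3 + y) (8 (1 + y))^2, the bound for pieces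
   of large density. *)
exists 1024; first by rewrite ltr0n.
move=> j x x0; set y := lnp (x / 2); have y0 : 0 <= y by exact: lnp_ge0.
have /andP[l2 l1] := ln2_bounds; set l : R := ln 2 in l2 l1.
have j0 : 0 <= j%:R :> R by [].
have J0 : 0 < (1 + j%:R) ^+ 2 :> R by rewrite exprn_gt0// ltr_pwDl.
rewrite ge_min ler_pdivlMr// ler_pdivlMr//; apply/orP.
(* Since ln 2 >= 1/2, the first case gives j <= 8 y. In the second, a quarter of the decay 2^-j pays
   for the factor e^y in x <= 2 e^y. *)
have [yj|jy] := leP (j%:R * l) (4 * y).
  right.
  have h1 : 1 + lnp (2 * x) <= 3 + y.
    rewrite -lerBrDl ge_max; apply/andP; split; last by lra.
    have [->|xn0] := eqVneq x 0; first by rewrite mulr0 ln0//; lra.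
    have xp : 0 < x by rewrite lt_neqAle eq_sym xn0.
    have -> : 2 * x = 2 * (2 * (x / 2)) by field.
    have x2 : 0 < x / 2 by rewrite divr_gt0.
    rewrite lnM ?posrE ?mulr_gt0// lnM ?posrE//.
    have : ln (x / 2) <= y by rewrite /y /lnp le_max lexx.
    by rewrite -/l; lra.
  have h2 : 1 + j%:R <= 8 * (1 + y) by nra.
  apply: (@le_trans _ _ ((3 + y) * (8 * (1 + y)) ^+ 2)).
    apply: ler_pM => //; first by rewrite addr_ge0// lnp_ge0.
    by rewrite lerXn2r ?nnegrE ?addr_ge0// mulr_ge0// addr_ge0.
  have [y1|y1] := leP y 1.
    have : y ^+ 2 <= 1 by rewrite exprn_ile1.
    have : y ^+ 3 <= 1 by rewrite exprn_ile1.
    have : 0 <= y ^+ 4 by rewrite exprn_ge0.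
    have -> : (3 + y) * (8 * (1 + y)) ^+ 2 = 64 * (3 + 7 * y + 5 * y ^+ 2 + y ^+ 3) by ring.
    lra.
  have y1' := ltW y1.
  have : y <= y ^+ 4 by rewrite ler_eXnr.
  have : y ^+ 2 <= y ^+ 4 by rewrite ler_weXn2l.
  have : y ^+ 3 <= y ^+ 4 by rewrite ler_weXn2l.
  have -> : (3 + y) * (8 * (1 + y)) ^+ 2 = 64 * (3 + 7 * y + 5 * y ^+ 2 + y ^+ 3) by ring.
  lra.
left.
have xe : x <= 2 * expR y.
  have [->|xn0] := eqVneq x 0; first by rewrite mulr_ge0// expR_ge0.
  have xp : 0 < x by rewrite lt_neqAle eq_sym xn0.
  rewrite -ler_pdivrMl// mulrC -[leLHS]lnK ?posrE ?divr_gt0// ler_expR.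
  by rewrite /y /lnp le_max lexx.
have e2 : (2 ^+ j)^-1 = expR (- (j%:R * l)) :> R.
  by rewrite expRN expRM_natl lnK ?posrE.
(* 2 t is the remaining three quarters of j ln 2; halving it lets 1 + t <= e^t be squared. *)
pose t : R := 3 / 8 * j%:R * l.
have et : (1 + t) ^+ 2 <= expR (t + t).
  rewrite expRD expr2; apply: ler_pM; rewrite ?expR_ge1Dx// ?addr_ge0// ?mulr_ge0//; lra.
have h3 : 2 / 2 ^+ j * x <= 4 * expR (- (t + t)).
  rewrite e2 (_ : - (j%:R * l) = - (t + t) + - (j%:R * l / 4)); last by rewrite /t; field.
  rewrite expRD.
  have : expR (- (j%:R * l / 4)) * expR y <= 1.
    by rewrite -expRD -[leRHS]expR0 ler_expR; lra.
  have := expR_gt0 (- (t + t)); have := expR_gt0 (- (j%:R * l / 4)).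
  move: (expR _) (expR (- (j%:R * l / 4))) (expR y) xe => a b e xe b0 a0 be.
  have : a * (b * x) <= a * (b * (2 * e)) by rewrite !ler_wpM2l// ltW.
  have : a * (b * e) <= a * 1 by rewrite ler_wpM2l// ltW.
  lra.
apply: (@le_trans _ _ (4 * expR (- (t + t)) * (1 + j%:R) ^+ 2)).
  by rewrite ler_wpM2r// ltW.
(* As ln 2 >= 1/2, t >= 3 j / 16; hence the factor 16/3. *)
have h4 : (1 + j%:R) ^+ 2 <= (16 / 3) ^+ 2 * expR (t + t).
  apply: (@le_trans _ _ ((16 / 3) ^+ 2 * (1 + t) ^+ 2)); last by rewrite ler_wpM2l// exprn_ge0.
  rewrite -exprMn lerXn2r ?nnegrE ?addr_ge0//; rewrite /t; nra.
have y40 : 0 <= y ^+ 4 by rewrite exprn_ge0.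
have eE : expR (- (t + t)) * expR (t + t) = 1 by rewrite -expRD addNr expR0.
have : expR (- (t + t)) * (1 + j%:R) ^+ 2 <= (16 / 3) ^+ 2.
  apply: (@le_trans _ _ (expR (- (t + t)) * ((16 / 3) ^+ 2 * expR (t + t)))).
    by rewrite ler_wpM2l// expR_ge0.
  by rewrite mulrCA eE mulr1.
rewrite -mulrA; lra.
Qed.

End Asymptotics.

(** * Dyadic intervals and the mass that the density gives them *)

Section DyadicIntervals.
Context {R : realType}.
Implicit Types (x y : R) (k j : nat).
Local Notation mu := (@lebesgue_measure R).

Definition dy k x : nat := Num.truncn (2 ^+ k * x).

(** Truncation sends negative reals to 0, so [dyadic k 0] contains them too; it remains convex, and
    [piece] cuts it down to (0,1). *)
Definition dyadic k j : pred R := fun x => dy k x == j.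

Lemma le_dy k x y : x <= y -> (dy k x <= dy k y)%N.
Proof. by move=> xy; apply: le_truncn; rewrite ler_pM2l// exprn_gt0. Qed.

Lemma dyadic_convex k j : convex_pred (dyadic k j).
Proof.
move=> x y z /eqP xj /eqP zj /ltW/(le_dy k) + /ltW/(le_dy k).
by rewrite /dyadic xj zj eqn_leq => -> ->.
Qed.

Lemma measurable_dyadic k j : measurable [set x | dyadic k j x].
Proof.
apply: is_interval_measurable => x y /= /eqP xj /eqP yj z /andP[/(le_dy k) xz /(le_dy k) zy].
by rewrite /dyadic eqn_leq -{1}yj zy -xj xz.
Qed.

Lemma dyE k x n : 0 <= x -> (dy k x == n) = (n%:R / 2 ^+ k <= x < n.+1%:R / 2 ^+ k).
Proof.
move=> x0; have p : 0 < 2 ^+ k :> R by rewrite exprn_gt0.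
have y0 : 0 <= 2 ^+ k * x by rewrite mulr_ge0// exprn_ge0.
by rewrite /dy truncn_eq// ler_pdivrMr// ltr_pdivlMr// mulrC.
Qed.

Lemma dy_lt k x : 0 <= x < 1 -> (dy k x < 2 ^ k)%N.
Proof.
move=> /andP[x0 x1]; have p : 0 < 2 ^+ k :> R by rewrite exprn_gt0.
have y0 : 0 <= 2 ^+ k * x by rewrite mulr_ge0// exprn_ge0.
by rewrite /dy truncn_lt_nat// natrX gtr_pMr.
Qed.

Lemma dyS_half k x : 0 <= x -> (dy k.+1 x)./2 = dy k x.
Proof.
move=> x0; have p : 0 < 2 ^+ k :> R by rewrite exprn_gt0.
have y0 : 0 <= 2 ^+ k * x by rewrite mulr_ge0// exprn_ge0.
rewrite /dy exprS -mulrA; move: (2 ^+ k * x) y0 => y y0.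
have y20 : 0 <= 2 * y by rewrite mulr_ge0.
apply/esym/eqP; rewrite truncn_eq//.
have /andP[h1 h2] := truncn_itv y20.
have := odd_double_half (Num.truncn (2 * y)).
move: (Num.truncn (2 * y)) h1 h2 => n; move: (odd n) (n./2) => b m + + nE.
rewrite -nE -[(_ + _).+1%:R]natr1 -[m.+1%:R]natr1 natrD -mul2n natrM.
by case: b {nE} => /=; lra.
Qed.

Definition piece k j : set R := [set x | dyadic k j x] `&` `]0, 1[%classic.

Lemma measurable_piece k j : measurable (piece k j).
Proof. by apply: measurableI; [exact: measurable_dyadic|exact: measurable_itv]. Qed.

(** The piece lies between the open and the closed interval with the same endpoints, which covers j
    = 0, where the left endpoint is missing. *)
Lemma measure_piece k j : (j < 2 ^ k)%N -> mu (piece k j) = (2 ^- k)%:E.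
Proof.
move=> jk; have p : 0 < 2 ^+ k :> R by rewrite exprn_gt0.
have ab : j%:R / 2 ^+ k < j.+1%:R / 2 ^+ k :> R by rewrite ltr_pM2r ?invr_gt0// ltr_nat.
have d : j.+1%:R / 2 ^+ k - j%:R / 2 ^+ k = 2 ^- k :> R.
  by rewrite -mulrBl -natr1 addrAC subrr add0r mul1r.
have a0 : 0 <= j%:R / 2 ^+ k :> R by rewrite divr_ge0// ltW.
have b1 : j.+1%:R / 2 ^+ k <= 1 :> R.
  by rewrite ler_pdivrMr// mul1r -natrX ler_nat.
apply/eqP; rewrite eq_le; apply/andP; split.
  rewrite (@le_trans _ _ (mu `[j%:R / 2 ^+ k, j.+1%:R / 2 ^+ k]%classic))//.
    rewrite le_measure ?inE//; first exact: measurable_piece.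
    move=> x [/= xj]; rewrite in_itv /= => /andP[/ltW x0 _].
    by move: xj; rewrite /dyadic dyE// in_itv /= => /andP[-> /ltW ->].
  by rewrite lebesgue_measure_itv /= lte_fin ab -EFinB d.
rewrite (@le_trans _ _ (mu `]j%:R / 2 ^+ k, j.+1%:R / 2 ^+ k[%classic))//.
  by rewrite lebesgue_measure_itv /= lte_fin ab -EFinB d.
rewrite le_measure ?inE//; first exact: measurable_piece.
move=> x /=; rewrite in_itv /= => /andP[ax xb].
have x0 := le_lt_trans a0 ax.
by split; rewrite /= ?in_itv /= ?x0 ?(lt_le_trans xb)// /dyadic dyE ?ltW//= ?xb ?ltW.
Qed.

Lemma integral_piece_cst k j (c : R) : (j < 2 ^ k)%N ->
  (\int[mu]_(x in piece k j) c%:E = (c * 2 ^- k)%:E)%E.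
Proof.
move=> jk; rewrite integral_cst; last exact: measurable_piece.
by rewrite [X in (_ * X)%E](measure_piece jk).
Qed.

Lemma integral_pieces k (g : R -> \bar R) :
  measurable_fun (`]0, 1[%classic : set R) g ->
  (forall x, (`]0, 1[%classic : set R) x -> (0 <= g x)%E) ->
  (\sum_(j < 2 ^ k) \int[mu]_(x in piece k j) g x =
   \int[mu]_(x in `]0%R, 1%R[%classic) g x)%E.
Proof.
move=> mg g0.
have E : \big[setU/set0]_(j <- index_enum 'I_(2 ^ k)) piece k j = `]0, 1[%classic.
  rewrite -bigcup_seq; apply/seteqP; split => x; first by move=> [j _ []].
  move=> /[dup] x01; rewrite /= in_itv /= => /andP[x0 x1].
  have xk : (dy k x < 2 ^ k)%N by rewrite dy_lt// ltW.
  by exists (Ordinal xk); [rewrite /= mem_index_enum|split => //=; rewrite /dyadic eqxx].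
rewrite -(@ge0_integral_bigsetU _ _ _ mu 'I_(2 ^ k) (fun j : 'I_(2 ^ k) => piece k j)) ?E//.
- by move=> j; exact: measurable_piece.
- exact: index_enum_uniq.
- by move=> i j _ _ [x [[/= /eqP xi _] [/= /eqP xj _]]]; apply: val_inj; rewrite /= -xi -xj.
Qed.

Section Mass.
Variable f : R -> R.
Hypothesis df : is_density01 f.

Definition mass k j : R := fine (\int[mu]_(x in piece k j) (f x)%:E)%E.

Let mf : measurable_fun (`]0, 1[%classic : set R) (EFin \o f).
Proof. by case: df => + _ _; move/measurable_EFinP. Qed.

Let f0 x : (`]0, 1[%classic : set R) x -> 0 <= f x.
Proof. by case: df => _ + _; apply. Qed.

Lemma massE k j : ((mass k j)%:E = \int[mu]_(x in piece k j) (f x)%:E)%E.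
Proof.
rewrite /mass fineK// ge0_fin_numE; last first.
  by apply: integral_ge0 => x [_ /f0]; rewrite lee_fin.
case: df => _ _ f1; rewrite (@le_lt_trans _ _ 1%E) ?ltry// -f1.
apply: ge0_subset_integral => //; first exact: measurable_piece.
by move=> x [].
Qed.

Lemma mass_ge0 k j : 0 <= mass k j.
Proof.
by rewrite -lee_fin massE; apply: integral_ge0 => x [_ /f0]; rewrite lee_fin.
Qed.

Lemma sum_mass k : \sum_(j < 2 ^ k) mass k j = 1.
Proof.
apply: EFin_inj; rewrite -sumEFin; under eq_bigr do rewrite massE.
by rewrite integral_pieces//; case: df.
Qed.

Lemma mass_le1 k (j : 'I_(2 ^ k)) : mass k j <= 1.
Proof.
rewrite -(sum_mass k) (bigD1 j)//= lerDl sumr_ge0// => i _; exact: mass_ge0.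
Qed.

Lemma measurable_lnp4 : measurable_fun (`]0, 1[%classic : set R) (fun x => f x * lnp (f x) ^+ 4).
Proof.
case: df => mf' _ _; apply: measurable_funM => //; apply: measurable_funX.
apply: measurable_maxr; last exact: measurable_cst.
by apply: measurableT_comp => //; exact: measurable_ln.
Qed.

(* Since f w(f) >= (f - t) w(t) for nondecreasing w, comparing f with half its
   mean value over the piece costs only a factor 2. *)
Lemma sum_mass_lnp k :
  (\int[mu]_(x in `]0%R, 1%R[%classic) (f x * lnp (f x) ^+ 4)%:E < +oo)%E ->
  \sum_(j < 2 ^ k) mass k j * lnp (2 ^+ k * mass k j / 2) ^+ 4 <=
  2 * fine (\int[mu]_(x in `]0%R, 1%R[%classic) (f x * lnp (f x) ^+ 4)%:E)%E.
Proof.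
move=> fin.
have g0 x : (`]0, 1[%classic : set R) x -> (0 <= (f x * lnp (f x) ^+ 4)%:E)%E.
  by move=> /f0 fx; rewrite lee_fin mulr_ge0// exprn_ge0// lnp_ge0.
have mg : measurable_fun (`]0, 1[%classic : set R) (fun x => (f x * lnp (f x) ^+ 4)%:E).
  by apply/measurable_EFinP; exact: measurable_lnp4.
rewrite -lee_fin EFinM fineK; last by rewrite ge0_fin_numE// integral_ge0.
rewrite -(integral_pieces k mg g0) -sumEFin ge0_sume_distrr; last first.
  by move=> j _; apply: integral_ge0 => x [_]; exact: g0.
apply: lee_sum => j _; set m := mass k j; set t := 2 ^+ k * m / 2.
have p : 0 < 2 ^+ k :> R by rewrite exprn_gt0.
have m0 : 0 <= m := mass_ge0 k j.
have t0 : 0 <= t by rewrite divr_ge0// mulr_ge0// ltW.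
set w := lnp t ^+ 4; have w0 : 0 <= w by rewrite exprn_ge0// lnp_ge0.
have sub : piece k j `<=` `]0, 1[%classic by move=> x [].
have mP := measurable_piece k j.
(* The pointwise inequality is integrated with t w(t) moved to the right, so that every integrand is
   nonnegative. *)
have H : (w%:E * m%:E <= \int[mu]_(x in piece k j) (f x * lnp (f x) ^+ 4)%:E + (t * w)%:E * (2 ^- k)%:E)%E.
  rewrite -(measure_piece (ltn_ord j)) -integral_cst// -ge0_integralD//; last 3 first.
  - by move=> x /sub; exact: g0.
  - exact: measurable_funS mg.
  - by move=> x _; rewrite lee_fin mulr_ge0.
  rewrite massE -ge0_integralZl_EFin//; last 2 first.
  - by move=> x /sub/f0; rewrite lee_fin.
  - exact: measurable_funS mf.
  apply: ge0_le_integral => //.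
  - by move=> x /sub/f0 fx; rewrite -EFinM lee_fin mulr_ge0.
  - apply: measurable_funeM; exact: measurable_funS mf.
  - apply: emeasurable_funD => //; exact: measurable_funS mg.
  move=> x /sub/f0 fx; rewrite -EFinM -EFinD lee_fin.
  have [ft|tf] := leP (f x) t.
    have : 0 <= f x * lnp (f x) ^+ 4 by rewrite mulr_ge0// exprn_ge0// lnp_ge0.
    have : w * f x <= w * t by rewrite ler_wpM2l.
    lra.
  have : f x * w <= f x * lnp (f x) ^+ 4.
    rewrite ler_wpM2l// lerXn2r ?nnegrE ?lnp_ge0// le_lnp// ltW//.
  have : 0 <= t * w by rewrite mulr_ge0.
  lra.
(* As t is half the mean value, the extra term is half the left side and is absorbed there. *)
have tk : t * w * 2 ^- k = m * w / 2.
  by rewrite /t; field; rewrite gt_eqF.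
have J0 : (0 <= \int[mu]_(x in piece k j) (f x * lnp (f x) ^+ 4)%:E)%E.
  by apply: integral_ge0 => x /sub; exact: g0.
move: H J0; rewrite -!EFinM tk; case: (integral _ _ _) => [r| |] //.
  by rewrite -EFinD !lee_fin => H _; change ((m * w)%:E <= (2 * r)%:E)%E; rewrite lee_fin; lra.
by rewrite gt0_muley ?leey.
Qed.

(** 2^k times the mass is the mean density of the interval: [dyadic_tail_le] is applied to it, and
    [sum_mass_lnp] sums the fourth powers. The level k and the offset j are independent, so C serves
    all of them. *)
Lemma sum_mass_tail :
  (\int[mu]_(x in `]0%R, 1%R[%classic) (f x * lnp (f x) ^+ 4)%:E < +oo)%E ->
  exists2 C : R, 0 < C & forall k (j : nat), \sum_(i < 2 ^ k) mass k i *
    Num.min (2 / 2 ^+ j * (2 ^+ k * mass k i)) (1 + lnp (2 * (2 ^+ k * mass k i))) <=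
  C / (1 + j%:R) ^+ 2.
Proof.
move=> fin; set M := fine (\int[mu]_(x in `]0%R, 1%R[%classic) (f x * lnp (f x) ^+ 4)%:E)%E.
have M0 : 0 <= M.
  by apply/fine_ge0/integral_ge0 => x /f0 fx; rewrite lee_fin mulr_ge0// exprn_ge0// lnp_ge0.
have [C C0 HC] := @dyadic_tail_le R.
exists (C * (1 + 2 * M)); first by rewrite mulr_gt0// ltr_pwDl// mulr_ge0.
move=> k j; apply: (@le_trans _ _ (\sum_(i < 2 ^ k) mass k i *
    (C * (1 + lnp (2 ^+ k * mass k i / 2) ^+ 4) / (1 + j%:R) ^+ 2))).
  apply: ler_sum => i _; rewrite ler_wpM2l ?mass_ge0// HC//.
  by rewrite mulr_ge0 ?mass_ge0// exprn_ge0.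
rewrite (eq_bigr (fun i : 'I_(2 ^ k) => C * (mass k i + mass k i * lnp (2 ^+ k * mass k i / 2) ^+ 4) / (1 + j%:R) ^+ 2)); last first.
  by move=> i _; rewrite mulrA mulrCA mulrDr mulr1.
rewrite -mulr_suml -mulr_sumr ler_wpM2r ?invr_ge0 ?exprn_ge0 ?addr_ge0//.
rewrite ler_wpM2l ?(ltW C0)// big_split sum_mass lerD2l.
exact: sum_mass_lnp.
Qed.

End Mass.

Lemma density_unif : is_density01 (fun=> 1 : R).
Proof.
split=> //; rewrite integral_cst//= mul1e lebesgue_measure_itv/= lte_fin ltr01.
by rewrite -EFinB subr0.
Qed.

Lemma mass_unif k j : (j < 2 ^ k)%N -> mass (fun=> 1 : R) k j = 2 ^- k.
Proof.
by move=> jk; rewrite /mass integral_piece_cst// mul1r.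
Qed.

End DyadicIntervals.

(** * The bit cost as a sum over dyadic levels *)

Section Bits.
Context {R : realType}.
Implicit Types x y : R.

(** The bit of index k + 1 is the parity of [dy k.+1], and halving [dy k.+1] gives back [dy k]. *)
Lemma eq_dy_bits x y k : 0 <= x < 1 -> 0 <= y < 1 ->
  (dy k x == dy k y) = all (fun i => bit x i == bit y i) (iota 1 k).
Proof.
move=> x01 y01; elim: k => [|k IH].
  by have := dy_lt 0 x01; have := dy_lt 0 y01; rewrite !ltnS !leqn0 => /eqP -> /eqP ->.
have /andP[x0 _] := x01; have /andP[y0 _] := y01.
rewrite (_ : iota 1 k.+1 = iota 1 k ++ [:: k.+1]); last first.
  by have := iotaD 1 k 1; rewrite addn1 add1n.
rewrite all_cat -IH /= andbT.
rewrite (_ : bit x k.+1 = odd (dy k.+1 x))// (_ : bit y k.+1 = odd (dy k.+1 y))//.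
apply/eqP/andP => [xy|[/eqP xy /eqP b]]; first by rewrite -(dyS_half k x0) -(dyS_half k y0) xy.
by rewrite -[LHS]odd_double_half -[RHS]odd_double_half b (dyS_half k x0) (dyS_half k y0) xy.
Qed.

Lemma eq_dyP x y k : 0 <= x < 1 -> 0 <= y < 1 -> x != y ->
  (dy k x == dy k y) = (k < first_diff_bit x y)%N.
Proof.
move=> x01 y01 xy; rewrite /first_diff_bit; case: pselect => [h|nh].
  case: ex_minnP => m /andP[m0 bm] mmin; rewrite eq_dy_bits//.
  apply/allP/idP => [ab|km i].
    rewrite ltnNge; apply/negP => mk; move/negP: bm; apply; apply: ab.
    by rewrite mem_iota m0 add1n ltnS.
  rewrite mem_iota add1n ltnS => /andP[i0 ik]; apply/negPn/negP => bi.
  have /mmin : bits_differ x y i by rewrite /bits_differ /= i0.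
  by rewrite leqNgt (leq_ltn_trans ik).
(* Without a differing bit, x and y share a dyadic interval at every level i, so |x - y| <= 2^-i for
   all i. *)
exfalso; have eqk i : dy i x = dy i y.
  apply/eqP; rewrite eq_dy_bits//; apply/allP => l; rewrite mem_iota => /andP[l0 _].
  by apply/negPn/negP => bl; apply: nh; exists l; rewrite /bits_differ /= l0.
have /andP[x0 _] := x01; have /andP[y0 _] := y01.
have d i : `|x - y| <= 2 ^- i.
  have p : 0 < 2 ^+ i :> R by rewrite exprn_gt0.
  have := eqxx (dy i x); rewrite dyE//; have := eqxx (dy i x); rewrite {1}eqk dyE//.
  rewrite -[(dy i x).+1%:R]natr1 mulrDl mul1r => /andP[h1 h2] /andP[h3 h4].
  by rewrite ler_norml; apply/andP; split; lra.
have xy0 : 0 < `|x - y| by rewrite normr_gt0 subr_eq0.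
have := d (Num.truncn `|x - y|^-1).+1; rewrite leNgt => /negP; apply.
rewrite invf_plt ?posrE ?exprn_gt0//.
by rewrite (lt_trans (truncnS_gt _))// -natrX ltr_nat ltn_expl.
Qed.

Lemma first_diff_bit_series x y : 0 <= x < 1 -> 0 <= y < 1 -> x != y ->
  (\sum_(k <oo) (dy k x == dy k y)%:R%:E = (first_diff_bit x y)%:R%:E :> \bar R)%E.
Proof.
move=> x01 y01 xy.
rewrite (nneseries_split 0 (first_diff_bit x y)); last by move=> k _; rewrite lee_fin.
rewrite add0n eseries0 ?adde0; last first.
  by move=> k bk _; rewrite eq_dyP// ltnNge bk.
rewrite (eq_big_nat _ _ (F2 := fun=> 1%E)); last by move=> k /andP[_ kb]; rewrite eq_dyP// kb.
rewrite sumEFin (_ : \sum_(0 <= i < _) 1 = (\sum_(0 <= i < first_diff_bit x y) 1)%:R); last first.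
  by rewrite natr_sum.
by rewrite sum_nat_const_nat subn0 muln1.
Qed.

Lemma mem_comparisons pivot m v (s : seq R) xy :
  xy \in quicksort_comparisons pivot m v s ->
  [/\ xy.1 \in 0 :: s, xy.2 \in 0 :: s & xy.1 != xy.2].
Proof.
elim: m v s => [//|m IH] v s /=; case: ifP => // _.
have sub (P : pred R) i : i \in 0 :: [seq y <- s | P y] -> i \in 0 :: s.
  by rewrite !inE mem_filter => /orP[->//|/andP[_ ->]]; rewrite orbT.
rewrite !mem_cat => /orP[/mapP[y]|/orP[|] /IH[/sub ? /sub ?]//].
rewrite mem_filter => /andP[yp ys] -> /=; split; [|by rewrite inE ys orbT|by rewrite eq_sym].
have [h|h] := ltnP (pivot v (size s)) (size s); first by rewrite inE mem_nth ?orbT.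
by rewrite nth_default ?mem_head.
Qed.

Lemma sum_cmp_in_dyadic k (L : seq (R * R)) :
  {in L, forall xy, (0 <= xy.1 < 1) && (0 <= xy.2 < 1)} ->
  (\sum_(j < 2 ^ k) cmp_in (dyadic k j) L = count (fun xy => dy k xy.1 == dy k xy.2) L)%N.
Proof.
elim: L => [|xy L IH] L01; first by rewrite big1.
rewrite /= -IH; last by move=> z zL; apply: L01; rewrite inE zL orbT.
rewrite /cmp_in /= big_split /=; congr addn.
have /andP[x01 _] := L01 xy (mem_head _ _).
rewrite (bigD1 (Ordinal (dy_lt k x01)))//= big1 ?addn0.
  by rewrite /dyadic eqxx eq_sym.
by move=> j jx; rewrite {1}/dyadic [_ == _](_ : _ = false)//; apply/eqP => xj;
  move/eqP: jx; apply; apply: val_inj; rewrite /= xj.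
Qed.

Lemma bit_comparisons_series pivot (s : seq R) :
  {in s, forall x, 0 < x < 1} ->
  ((bit_comparisons pivot s)%:R%:E = \sum_(k <oo) \sum_(j < 2 ^ k)
     (cmp_in (dyadic k j) (quicksort_comparisons pivot (size s) [::] s))%:R%:E :> \bar R)%E.
Proof.
move=> s01; rewrite /bit_comparisons; set L := quicksort_comparisons _ _ _ _.
have {s01} L01 : {in L, forall xy, [/\ 0 <= xy.1 < 1, 0 <= xy.2 < 1 & xy.1 != xy.2]}.
  (* The default key 0 also lies in [0,1), so out-of-range pivots need no separate case. *)
  have s01' x : x \in 0 :: s -> 0 <= x < 1.
    by rewrite inE => /predU1P[->|/s01/andP[/ltW -> ->]//]; rewrite lexx ltr01.
  by move=> xy /mem_comparisons[/s01' ? /s01' ? ?].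
transitivity (\sum_(k <oo) (count (fun xy => dy k xy.1 == dy k xy.2) L)%:R%:E : \bar R)%E; last first.
  apply: eq_eseriesr => k _; rewrite sumEFin -sum_cmp_in_dyadic ?natr_sum//.
  by move=> xy /L01[-> ->].
elim: L L01 => [|xy L IH] L01.
  by rewrite big_nil eseries0.
rewrite big_cons natrD EFinD IH; last by move=> z zL; apply: L01; rewrite inE zL orbT.
have [x01 y01 xNy] := L01 xy (mem_head _ _).
rewrite -first_diff_bit_series// -nneseriesD//.
by apply: eq_eseriesr => k _; rewrite /= natrD EFinD.
Qed.

Section MeasurableBits.
Context d (T : measurableType d).

(** The event F = 0 is the complement of the others, so default values at 0 need no description. *)
Lemma discrete_nat (F : T -> nat) :
  (forall m, measurable [set w | F w = m.+1]) -> discrete_fun F.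
Proof.
move=> mF.
have mF' m : measurable [set w | F w = m].
  case: m => [|//]; rewrite (_ : [set w | _] = ~` \bigcup_m [set w | F w = m.+1]).
    by apply: measurableC; exact: bigcupT_measurable.
  apply/seteqP; split => w /=; first by move=> Fw [m _ /=]; rewrite Fw.
  by case E : (F w) => [//|m] h; exfalso; apply: h; exists m.
move=> B; rewrite (_ : F @^-1` B = \bigcup_(m in B) [set w | F w = m]).
  by apply: bigcup_measurable.
by apply/seteqP; split => w /=; [move=> BFw; exists (F w)|move=> [m Bm /= ->]].
Qed.

Lemma discrete_dy (x : T -> R) k : measurable_fun [set: T] x ->
  discrete_fun (fun w => dy k (x w)).
Proof.
move=> mx; apply: discrete_nat => m.
have := mx measurableT _ (measurable_dyadic k m.+1); rewrite setTI.
by rewrite (_ : _ @^-1` _ = [set w | dy k (x w) = m.+1])//; apply/seteqP; split => w /= /eqP.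
Qed.

Lemma discrete_first_diff_bit (x y : T -> R) :
  measurable_fun [set: T] x -> measurable_fun [set: T] y ->
  discrete_fun (fun w => first_diff_bit (x w) (y w)).
Proof.
move=> mx my; apply: discrete_nat => m.
pose D i := [set w | bits_differ (x w) (y w) i].
have mD i : measurable (D i).
  have : discrete_fun (fun w => bits_differ (x w) (y w) i).
    apply: (discrete_bind (F := fun w => dy i (x w)) (G := fun a w => (0 < i)%N && (odd a != odd (dy i (y w))))).
      exact: discrete_dy.
    by move=> a; apply: (discrete_comp (fun b => (0 < i)%N && (odd a != odd b))); exact: discrete_dy.
  by move=> /(_ [set true]).
have lP i : (i \in iota 0 m.+1) = (i < m.+1)%N by rewrite mem_iota.
move: (iota 0 m.+1) lP => l lP.
rewrite (_ : [set w | _] = D m.+1 `&` \big[setI/setT]_(i <- l) ~` D i).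
  by apply: measurableI => //; apply: bigsetI_measurable => i _; exact: measurableC.
rewrite -bigcap_seq; apply/seteqP; split => w; rewrite /first_diff_bit /=.
  case: pselect => // h; case: ex_minnP => n bn nmin nm; rewrite -nm; split=> //.
  move=> i /=; rewrite lP -nm => i_n /nmin.
  by rewrite leqNgt i_n.
move=> [Dm Di]; case: pselect => [h|nh]; last by exfalso; apply: nh; exists m.+1.
case: ex_minnP => n bn nmin; apply/eqP; rewrite eqn_leq nmin//= ltnNge.
by apply/negP => nm; apply: (Di n) bn; rewrite /= lP.
Qed.

End MeasurableBits.

End Bits.

(** * The mean number of bit comparisons as a double series *)

Section ModelMean.
Local Open Scope ereal_scope.
Context {R : realType} (f : R -> R) (lambda : R) d (T : measurableType d)
  (P : probability T R) (X : nat -> {RV P >-> R}) (N : {RV P >-> nat})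
  (pivot : seq bool -> nat -> {RV P >-> nat}).
Hypothesis model : quicksort_model f lambda X N pivot.
Hypothesis lambda0 : (0 < lambda)%R.

Lemma mean_qs_key_count (I : pred R) (p : R) : measurable [set x | I x] ->
  (forall i, P (X i @^-1` [set x | I x]) = p%:E) ->
  \int[P]_w (qs_mean (key_count X I (N w) w))%:E = (qs_poisson (lambda * p))%:E.
Proof.
move=> mI XI; have /andP[p0 p1] := prob_keys_in_01 mI XI.
have lp0 : (0 <= lambda * p)%R by rewrite mulr_ge0// ltW.
rewrite (integral_discrete_nat P (discrete_key_countN X N mI)); last exact: qs_mean_ge0.
have [lp] := qs_poissonP lp0.
rewrite -(eseries_cvg_series _ lp); last first.
  by move=> n; rewrite mulr_ge0 ?pois_ge0 ?qs_mean_ge0.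
apply: eq_eseriesr => c _; rewrite EFinM muleC; congr (_ * _).
have mA m : measurable ([set w | key_count X I m w = c] `&` [set w | N w = m]).
  apply: measurableI; first exact: (discrete_key_count X mI m [set c]).
  exact: (RV_discrete N [set m]).
have -> : [set w | key_count X I (N w) w = c] =
    \bigcup_m ([set w | key_count X I m w = c] `&` [set w | N w = m]).
  apply/seteqP; split => [w /= h|w [m _ [/= h ->]]] //.
  by exists (N w).
rewrite measure_bigcup//; last first.
  by move=> i j _ _ [w [[_ /= <-] [_ /= <-]]].
rewrite -(eseries_cvg_series _ (@thinning R lambda p c lambda0)); last first.
  by move=> m; rewrite !mulr_ge0 ?exprn_ge0 ?subr_ge0 ?poisson_pmf_ge0.
rewrite [LHS](eq_eseriesl (Q := xpredT)); last by move=> m; rewrite in_setT.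
by apply: eq_eseriesr => m _; exact: (key_count_prob model mI XI).
Qed.

Lemma discrete_bit_comparisons :
  discrete_fun (fun w => bit_comparisons (fun v n => pivot v n w) (keys X (N w) w)).
Proof.
apply: (discrete_bind (F := N) (G := fun n w =>
  bit_comparisons (fun v n => pivot v n w) (keys X n w))); first exact: RV_discrete.
move=> n; rewrite /bit_comparisons.
under eq_fun do rewrite keysE size_mkseq comparisons_pattern ?key_at_default// big_map.
apply: (discrete_bind (F := fun w => order_pattern (key_at X n w) n)
  (G := fun o w => (\sum_(ij <- qs_idx (pattern_lt o) n (fun v n => pivot v n w) n [::] (iota 0 n))
     first_diff_bit (key_at X n w ij.1) (key_at X n w ij.2))%N)).
  apply: discrete_order_pattern => i; exact: measurable_key_at.
move=> o; apply: (discrete_bind (G := fun L w => (\sum_(ij <- L)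
     first_diff_bit (key_at X n w ij.1) (key_at X n w ij.2))%N)).
  by apply: discrete_qs_idx => v k; exact: RV_discrete.
elim=> [|ij L IH]; first by under eq_fun do rewrite big_nil; exact: discrete_cst.
under eq_fun do rewrite big_cons.
apply: (discrete_bind (F := fun w => first_diff_bit (key_at X n w ij.1) (key_at X n w ij.2))
  (G := fun b w => (b + \sum_(ij <- L) first_diff_bit (key_at X n w ij.1) (key_at X n w ij.2))%N)).
  by apply: discrete_first_diff_bit; exact: measurable_key_at.
by move=> b; exact: (discrete_comp (fun c => (b + c)%N)).
Qed.

Hypothesis df : is_density01 f.

Lemma key_dyadic_prob k j i :
  P (X i @^-1` [set x | dyadic k j x]) = (mass f k j)%:E.
Proof.
by rewrite (keys_density model) ?massE//; exact: measurable_dyadic.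
Qed.

Lemma key_outside_null i : P (X i @^-1` (~` `]0%R, 1%R[%classic)) = 0.
Proof.
rewrite (keys_density model); last exact: measurableC.
by rewrite setICl integral_set0.
Qed.

Hypothesis fin_f : \int[@lebesgue_measure R]_(x in `]0%R, 1%R[%classic)
  (f x * lnp (f x) ^+ 4)%:E < +oo.

(** Equal keys in (0,1) share a dyadic interval at every level k, an event of probability the sum of
    the squared masses. [sum_mass_tail] with j = k bounds it by C / (1 + k)^2, since the minimum
    there is at least the mass. *)
Lemma key_collision_null i j : i != j ->
  P.-negligible [set w | X i w = X j w].
Proof.
move=> ij.
pose F k l := X i @^-1` [set x | dyadic k l x] `&` X j @^-1` [set x | dyadic k l x].
have mF k l : measurable (F k l).
  by apply: measurableI; apply: RV_measurable; exact: measurable_dyadic.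
pose S k := (X i @^-1` (~` `]0%R, 1%R[%classic)) `|` \big[setU/set0]_(l < 2 ^ k) F k l.
have mO : measurable (X i @^-1` (~` `]0%R, 1%R[%classic)).
  by apply: RV_measurable; exact: measurableC.
have mS k : measurable (S k).
  by apply: measurableU => //; apply: bigsetU_measurable => l _; exact: mF.
have [C C0 HC] := sum_mass_tail df fin_f.
have PF k l : P (F k l) = (mass f k l * mass f k l)%:E.
  have := key_event_prob model (l := [:: i; j]) (B := fun=> [set x | dyadic k l x]).
  rewrite /key_event !big_cons !big_nil setIT mule1 !key_dyadic_prob EFinM; apply.
    by rewrite /= inE ij.
  by move=> _; exact: measurable_dyadic.
have PS k : P (S k) <= (C / (1 + k%:R) ^+ 2)%:E.
  have mU : measurable (\big[setU/set0]_(l < 2 ^ k) F k l).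
    by apply: bigsetU_measurable => l _; exact: mF.
  have H : P (S k) <= P (X i @^-1` (~` `]0%R, 1%R[%classic)) +
      P (\big[setU/set0]_(l < 2 ^ k) F k l) by exact: measureU2.
  apply: (le_trans H); rewrite key_outside_null add0e measure_bigsetU//; last first.
    by move=> a b _ _ [w [[/= /eqP <- _] [/= /eqP <- _]]].
  apply: (@le_trans _ _ (\sum_(l < 2 ^ k) (mass f k l * mass f k l)%:E)).
    by apply: lee_sum => l _; rewrite -PF.
  rewrite sumEFin lee_fin (le_trans _ (HC k k))//.
  apply: ler_sum => l _; have m0 := mass_ge0 df k l; have m1 := mass_le1 df l.
  have p : (0 < 2 ^+ k :> R)%R by rewrite exprn_gt0.
  rewrite ler_wpM2l// le_min; apply/andP; split.
    rewrite mulrA divfK ?gt_eqF//; lra.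
  by have := lnp_ge0 (2 * (2 ^+ k * mass f k l))%R; lra.
exists (\bigcap_k S k); split.
- exact: bigcapT_measurable.
- apply/eqP; rewrite eq_le measure_ge0 andbT.
  apply/lee_addgt0Pr => e e0; rewrite add0e.
  pose k := Num.truncn (C / e).
  apply: (@le_trans _ _ (P (S k))).
    apply: le_measure; rewrite ?inE//; first exact: bigcapT_measurable.
    by move=> w; apply.
  apply: (le_trans (PS k)); rewrite lee_fin ler_pdivrMr ?exprn_gt0//.
  have : (C / e < k.+1%:R)%R by exact: truncnS_gt.
  rewrite -natr1 ltr_pdivrMr// => h; have k0 : (0 <= k%:R :> R)%R by [].
  by rewrite expr2; nra.
move=> w /= Xij k _; have [x01|] := boolP (X i w \in `]0%R, 1%R[); last first.
  by move=> /negP x01; left.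
right; rewrite -(bigcup_mkord (2 ^ k) (F k)); exists (dy k (X i w)).
  by apply: dy_lt; move: x01; rewrite in_itv /= => /andP[/ltW -> ->].
by split; rewrite /= /dyadic // -Xij.
Qed.

Lemma model_null_set : exists N0 : set T, [/\ measurable N0, P N0 = 0,
  (forall w, ~ N0 w -> injective (fun i => X i w)) &
  (forall w, ~ N0 w -> forall i, (0 < X i w < 1)%R)].
Proof.
pose O := \bigcup_i (X i @^-1` (~` `]0%R, 1%R[%classic)).
pose K := \bigcup_i \bigcup_j [set w | i != j /\ X i w = X j w].
have nK : P.-negligible (O `|` K).
  apply: negligibleU; apply: negligible_bigcup => i.
    exists (X i @^-1` (~` `]0%R, 1%R[%classic)); split => //; last exact: key_outside_null.
    by apply: RV_measurable; exact: measurableC.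
  apply: negligible_bigcup => j; have [->|ij] := eqVneq i j.
    by apply: negligibleS (negligible_set0 _) => w [/eqP].
  by apply: negligibleS (key_collision_null ij) => w [].
have [A [mA A0 OKA]] := nK; exists A; split => // w nA.
  move=> i j Xij; apply: contrapT => /eqP ij; apply: nA; apply: OKA; right.
  by exists i => //; exists j.
move=> i; apply: contrapT => nX; apply: nA; apply: OKA; by left; exists i => //=; rewrite in_itv.
Qed.

Lemma mean_bit_comparisons_model :
  'E_P[fun w => (bit_comparisons (fun v n => pivot v n w) (keys X (N w) w))%:R] =
  \sum_(k <oo) \sum_(j < 2 ^ k) (qs_poisson (lambda * mass f k j))%:E.
Proof.
have [N0 [mN0 PN0 inj01 X01]] := model_null_set.
rewrite unlock.
pose Z k j w : \bar R := (cmp_in (dyadic k j) (comparisons X N pivot w))%:R%:E.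
have mZ k j : measurable_fun [set: T] (Z k j).
  apply/measurable_EFinP/discrete_measurable.
  apply: (discrete_comp (fun n : nat => n%:R : R)).
  exact: (discrete_cmp_comparisons X N pivot (measurable_dyadic k j)).
have Z0 k j w : 0 <= Z k j w by rewrite lee_fin.
have mB : measurable_fun [set: T] (fun w => ((bit_comparisons
    (fun v n => pivot v n w) (keys X (N w) w))%:R%:E : \bar R)).
  apply/measurable_EFinP/discrete_measurable.
  exact: (discrete_comp (fun n : nat => n%:R : R) discrete_bit_comparisons).
have mS k : measurable_fun [set: T] (fun w => \sum_(j < 2 ^ k) Z k j w).
  by apply: emeasurable_sum => j; exact: mZ.
rewrite (@ge0_ae_eq_integral _ _ _ P setT _
  (fun w => \sum_(k <oo) \sum_(j < 2 ^ k) Z k j w))//; last 3 first.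
- apply: (@ge0_emeasurable_sum _ _ _ setT (fun k w => \sum_(j < 2 ^ k) Z k j w) xpredT).
    by move=> k w _ _; exact: sume_ge0.
  by move=> k _; exact: mS.
- by move=> w _; apply: nneseries_ge0 => k _ _; apply: sume_ge0.
- exists N0; split => // w /= nB; apply: contrapT => nN0w; apply: nB => _.
  rewrite bit_comparisons_series.
    by rewrite /Z /comparisons /keys size_mkseq.
  by move=> x /mapP[i _ ->]; exact: X01.
rewrite integral_nneseries//; last by move=> k w _; exact: sume_ge0.
apply: eq_eseriesr => k _; rewrite ge0_integral_sum//.
apply: eq_bigr => j _.
rewrite (mean_cmp_model model (@dyadic_convex _ k j) (measurable_dyadic k j) PN0 mN0 inj01).
apply: mean_qs_key_count; first exact: measurable_dyadic.
exact: key_dyadic_prob.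
Qed.

End ModelMean.

Lemma mean_bit_comparisonsE {R : realType} (f : R -> R) (lambda : R) (m : \bar R) :
  is_density01 f ->
  (\int[@lebesgue_measure R]_(x in `]0%R, 1%R[%classic)
     (f x * lnp (f x) ^+ 4)%:E < +oo)%E ->
  0 < lambda -> is_mean_bit_comparisons f lambda m ->
  (m = \sum_(k <oo) \sum_(j < 2 ^ k) (qs_poisson (lambda * mass f k j))%:E)%E.
Proof.
move=> df fin l0 [d [T [P [X [N [pivot [model ->]]]]]]].
exact: (mean_bit_comparisons_model model l0 df fin).
Qed.

(** * The function y ln y *)

Section XLnX.
Context {R : realType}.
Implicit Types (x y t : R).

(* Tangent to the convex function y ln y at t. *)
Lemma xlnx_ge_tangent y t : 0 <= y -> 0 < t -> y * (1 + ln t) - t <= y * ln y.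
Proof.
move=> y0 t0; have [->|yn0] := eqVneq y 0; first by rewrite !mul0r sub0r oppr_le0 ltW.
have yp : 0 < y by rewrite lt_neqAle eq_sym yn0.
have := @le_ln1Dx R (t / y - 1).
rewrite addrCA subrr addr0 ltrBrDr addNr divr_gt0// => /(_ isT).
rewrite ln_div ?posrE// => h.
have : y * (ln t - ln y) <= y * (t / y - 1) by rewrite ler_wpM2l.
by rewrite [y * (t / y - 1)]mulrBr mulrCA divff ?gt_eqF// !mulr1; lra.
Qed.

(** The tangent at 1 gives y ln y >= y - 1, so the shift by 1 makes the function nonnegative for y
    >= 0. *)
Definition xlnx1 y := y * ln y + 1.

Lemma xlnx1_ge0 y : 0 <= y -> 0 <= xlnx1 y.
Proof. by move=> y0; have := xlnx_ge_tangent y0 ltr01; rewrite ln1 /xlnx1; lra. Qed.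

Lemma xlnx1_le y : 0 <= y -> xlnx1 y <= y * lnp y ^+ 4 + y + 1.
Proof.
move=> y0; rewrite lerD2r; have l0 := lnp_ge0 y.
have h1 : y * ln y <= y * lnp y by rewrite ler_wpM2l// /lnp le_max lexx.
have h2 : lnp y <= lnp y ^+ 4 + 1.
  have [l1|/ltW l1] := leP (lnp y) 1; first by rewrite (le_trans l1)// lerDr exprn_ge0.
  by rewrite (le_trans (_ : _ <= lnp y ^+ 4))// ?ler_eXnr// lerDl.
have : y * lnp y <= y * (lnp y ^+ 4 + 1) by rewrite ler_wpM2l.
lra.
Qed.

Lemma xlnx_cvg (u : nat -> R) y : (forall n, 0 <= u n) -> 0 <= y ->
  u @ \oo --> y -> (fun n => u n * ln (u n)) @ \oo --> y * ln y.
Proof.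
move=> u0 y0 uy; have [y_eq0|yn0] := eqVneq y 0; last first.
  have yp : 0 < y by rewrite lt_neqAle eq_sym yn0.
  apply: cvgM => //; apply: (cvg_comp _ _ uy); exact: continuous_ln.
rewrite y_eq0 mul0r; apply/cvgrPdist_le => e e0.
(* The tangent at t bounds u ln u below by -u |1 + ln t| - t, which is at least -2 t = -e once u <=
   t / B. The upper bound is the sign of ln u for u <= 1. *)
pose t := e / 2; have t0 : 0 < t by rewrite divr_gt0.
pose B := 1 + `|1 + ln t|.
have B0 : 0 < B by rewrite ltr_pwDl.
have m0 : 0 < Num.min 1 (t / B) by rewrite lt_min ltr01 divr_gt0.
move: uy; rewrite y_eq0 => /cvgrPdist_le/(_ _ m0); apply: filterS => n.
rewrite sub0r normrN ger0_norm// le_min => /andP[u1 ut].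
rewrite sub0r normrN ler_norml; apply/andP; split; last first.
  rewrite (le_trans _ (ltW e0))// mulr_ge0_le0//; exact: ln_le0.
have h := xlnx_ge_tangent (u0 n) t0.
have h1 : u n * - `|1 + ln t| <= u n * (1 + ln t) by rewrite ler_wpM2l// lerNnormlW.
have h2 : u n * B <= t by rewrite -ler_pdivlMr.
have h3 := u0 n.
by move: h2 h; rewrite /B /t; lra.
Qed.

End XLnX.

(** * Convergence of the dyadic entropies to the entropy *)

Section Entropy.
Context {R : realType} (f : R -> R).
Local Notation mu := (@lebesgue_measure R).
Hypothesis df : is_density01 f.
Hypothesis fin_f : (\int[mu]_(x in `]0%R, 1%R[%classic)
  (f x * lnp (f x) ^+ 4)%:E < +oo)%E.

Let mf : measurable_fun (`]0, 1[%classic : set R) f.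
Proof. by case: df. Qed.

Let f0 x : (`]0, 1[%classic : set R) x -> 0 <= f x.
Proof. by case: df => _ + _; apply. Qed.

Let f1 : (\int[mu]_(x in `]0%R, 1%R[%classic) (f x)%:E = 1)%E.
Proof. by case: df. Qed.

Let mu01 : mu (`]0%R, 1%R[%classic : set R) = 1%E.
Proof. by rewrite lebesgue_measure_itv/= lte_fin ltr01 -EFinB subr0. Qed.

(** The integral of f ln f, that is, the entropy in nats: (0,1) has measure 1, so subtracting 1
    undoes the shift in [xlnx1]. *)
Definition nat_entropy : R :=
  fine (\int[mu]_(x in `]0%R, 1%R[%classic) (xlnx1 (f x))%:E)%E - 1.

Let mh : measurable_fun (`]0, 1[%classic : set R) (fun x => xlnx1 (f x)).
Proof.
apply: measurable_funD; last exact: measurable_cst.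
by apply: measurable_funM => //; apply: measurableT_comp => //; exact: measurable_ln.
Qed.

Let h0 x : (`]0, 1[%classic : set R) x -> (0 <= (xlnx1 (f x))%:E)%E.
Proof. by move=> /f0 fx; rewrite lee_fin xlnx1_ge0. Qed.

Lemma integral_xlnx1 :
  (\int[mu]_(x in `]0%R, 1%R[%classic) (xlnx1 (f x))%:E = (nat_entropy + 1)%:E)%E.
Proof.
rewrite /nat_entropy subrK fineK// ge0_fin_numE ?integral_ge0//.
have g0 x : (`]0, 1[%classic : set R) x -> (0 <= (f x * lnp (f x) ^+ 4)%:E)%E.
  by move=> /f0 fx; rewrite lee_fin mulr_ge0// exprn_ge0// lnp_ge0.
have mg : measurable_fun (`]0, 1[%classic : set R) (fun x => (f x * lnp (f x) ^+ 4)%:E).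
  by apply/measurable_EFinP; exact: measurable_lnp4.
have mfE : measurable_fun (`]0, 1[%classic : set R) (fun x => (f x)%:E).
  exact/measurable_EFinP.
have f0E x : (`]0, 1[%classic : set R) x -> (0 <= (f x)%:E)%E by move=> /f0; rewrite lee_fin.
apply: (@le_lt_trans _ _ (\int[mu]_(x in `]0%R, 1%R[%classic)
   ((f x * lnp (f x) ^+ 4)%:E + (f x)%:E + 1%:E))%E).
  apply: ge0_le_integral => //.
  - exact/measurable_EFinP.
  - by apply: emeasurable_funD => //; apply: emeasurable_funD.
  - by move=> x /f0 fx; rewrite -!EFinD lee_fin xlnx1_le.
rewrite ge0_integralD//; last 2 first.
- by move=> x x01; rewrite adde_ge0 ?g0 ?f0E.
- exact: emeasurable_funD.
rewrite ge0_integralD// f1 integral_cst//= mu01 mul1e.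
by rewrite lte_add_pinfty ?ltry// lte_add_pinfty ?ltry.
Qed.

Lemma integrable_xlnx1 : mu.-integrable `]0%R, 1%R[%classic (fun x => (xlnx1 (f x))%:E).
Proof.
apply/integrableP; split; first exact/measurable_EFinP.
rewrite [X in (X < _)%E](_ : _ = (nat_entropy + 1)%:E) ?ltry// -integral_xlnx1.
by apply: eq_integral => x; rewrite inE => /h0 hx; rewrite gee0_abs.
Qed.

Lemma entropyE : entropy f = (nat_entropy / ln 2)%:E.
Proof.
have i1 : mu.-integrable `]0%R, 1%R[%classic (cst (1%:E : \bar R)).
  apply/integrableP; split; first exact: measurable_cst.
  rewrite [X in (X < _)%E](_ : _ = 1%E) ?ltry//.
  transitivity (\int[mu]_(x in `]0%R, 1%R[%classic) (cst 1 x))%E.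
    by apply: eq_integral => x _; rewrite /= normr1.
  by rewrite integral_cst//= mul1e mu01.
transitivity (\int[mu]_(x in `]0%R, 1%R[%classic)
    ((ln 2)^-1%:E * ((xlnx1 (f x))%:E - 1%:E)))%E.
  apply: eq_integral => x _; rewrite -EFinB -EFinM /xlnx1 addrK /lg.
  by rewrite mulrA mulrC.
rewrite integralZl//; last exact: integrableB integrable_xlnx1 i1.
rewrite integralB//; last exact: integrable_xlnx1.
by rewrite integral_xlnx1 integral_cst//= mu01 mul1e -EFinB addrK -EFinM mulrC.
Qed.

Definition dyadic_entropy k : R := \sum_(j < 2 ^ k) mass f k j * ln (2 ^+ k * mass f k j).

Lemma xlnx1_mass k j : xlnx1 (2 ^+ k * mass f k j) * 2 ^- k =
  mass f k j * ln (2 ^+ k * mass f k j) + 2 ^- k.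
Proof.
rewrite /xlnx1; field.
by rewrite gt_eqF// exprn_gt0.
Qed.

Lemma dyadic_entropyE k :
  dyadic_entropy k + 1 = \sum_(j < 2 ^ k) xlnx1 (2 ^+ k * mass f k j) * 2 ^- k.
Proof.
under eq_bigr do rewrite xlnx1_mass.
by rewrite big_split /= sumr_const card_ord -[_ *+ (2 ^ k)]mulr_natl natrX divff.
Qed.

(** Jensen's inequality by tangents: the tangent inequality at t is integrated over the piece, and t
    is then set to the mean density 2^k m. *)
Lemma xlnx1_piece_le k j : (j < 2 ^ k)%N ->
  ((xlnx1 (2 ^+ k * mass f k j) * 2 ^- k)%:E <=
   \int[mu]_(x in piece k j) (xlnx1 (f x))%:E)%E.
Proof.
move=> jk; set m := mass f k j; have m0 : 0 <= m := mass_ge0 df k j.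
have p : 0 < 2 ^+ k :> R by rewrite exprn_gt0.
have sub : piece k j `<=` (`]0, 1[%classic : set R) by move=> x [].
have mP := @measurable_piece R k j.
have H t : 0 < t -> ((m * (1 + ln t) - t * 2 ^- k + 2 ^- k)%:E <=
    \int[mu]_(x in piece k j) (xlnx1 (f x))%:E)%E.
  move=> t0; set a := 1 + ln t.
  (* The positive and negative parts of the slope go to opposite sides, which keeps both integrands
     nonnegative. *)
  pose ap := Num.max a 0; pose an := Num.max (- a) 0.
  have aE : a = ap - an by rewrite /ap /an; case: (leP a 0); case: (leP (- a) 0); lra.
  have ap0 : 0 <= ap by rewrite le_max lexx orbT.
  have an0 : 0 <= an by rewrite le_max lexx orbT.
  have mfP : measurable_fun (piece k j) (fun x => (f x)%:E).
    by apply/measurable_EFinP; exact: measurable_funS mf.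
  have mhP : measurable_fun (piece k j) (fun x => (xlnx1 (f x))%:E).
    by apply/measurable_EFinP; exact: measurable_funS mh.
  have : (\int[mu]_(x in piece k j) (ap%:E * (f x)%:E + 1%:E) <=
    \int[mu]_(x in piece k j) ((xlnx1 (f x))%:E + (an%:E * (f x)%:E + t%:E)))%E.
    apply: ge0_le_integral => //.
    - by move=> x /sub/f0 fx; rewrite -EFinM -EFinD lee_fin addr_ge0// mulr_ge0.
    - by apply: emeasurable_funD => //; exact: measurable_funeM.
    - by apply: emeasurable_funD => //; apply: emeasurable_funD => //; exact: measurable_funeM.
    move=> x /sub/f0 fx; rewrite -!EFinM -!EFinD lee_fin.
    by have := xlnx_ge_tangent fx t0; rewrite -/a aE /xlnx1; lra.
  have f0P x : piece k j x -> (0 <= (f x)%:E)%E by move=> /sub/f0; rewrite lee_fin.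
  rewrite !ge0_integralD//; last 8 first.
  - by move=> x /f0P fx; rewrite mule_ge0.
  - exact: measurable_funeM.
  - by move=> x _; rewrite lee_fin ltW.
  - by move=> x /sub; exact: h0.
  - by move=> x /f0P fx; rewrite adde_ge0 ?mule_ge0// lee_fin ltW.
  - by apply: emeasurable_funD => //; exact: measurable_funeM.
  - by move=> x /f0P fx; rewrite mule_ge0.
  - exact: measurable_funeM.
  rewrite !ge0_integralZl_EFin// !integral_piece_cst// -massE//.
  have : (0 <= \int[mu]_(x in piece k j) (xlnx1 (f x))%:E)%E.
    by apply: integral_ge0 => x /sub; exact: h0.
  rewrite aE -/m -!EFinM -!EFinD; case: (integral _ _ _) => [r| |] //.
    by rewrite -EFinD !lee_fin; lra.
  by move=> _ _; exact: leey.
have [mz|mn0] := eqVneq m 0; last first.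
  have mp : 0 < m by rewrite lt_neqAle eq_sym mn0.
  have := H (2 ^+ k * m) (mulr_gt0 p mp).
  rewrite (_ : _ + 2 ^- k = xlnx1 (2 ^+ k * m) * 2 ^- k)//.
  by rewrite /xlnx1; field; rewrite gt_eqF.
rewrite mz mulr0 (_ : xlnx1 0 = 1) ?mul1r; last by rewrite /xlnx1 mul0r add0r.
apply/lee_addgt0Pr => e e0.
(* With no mass the mean density 0 is not an admissible t; this positive t loses exactly e. *)
have := H (e * 2 ^+ k) (mulr_gt0 e0 p); rewrite mz mul0r sub0r mulfK ?gt_eqF//.
case: (integral _ _ _) => [r| |] //; first by rewrite -EFinD !lee_fin; lra.
by move=> _; rewrite addye// leey.
Qed.

Lemma dyadic_entropy_le k : dyadic_entropy k <= nat_entropy.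
Proof.
rewrite -(lerD2r 1) -lee_fin -integral_xlnx1 dyadic_entropyE -sumEFin.
rewrite -(integral_pieces k _ h0); last exact/measurable_EFinP.
by apply: lee_sum => j _; exact: xlnx1_piece_le.
Qed.

(** At level 0 the only piece has mass 1, so the dyadic entropy there is 0. *)
Lemma nat_entropy_ge0 : 0 <= nat_entropy.
Proof.
apply: le_trans (dyadic_entropy_le 0); rewrite /dyadic_entropy.
have := sum_mass df 0; rewrite !big_ord1 => ->.
by rewrite expr0 mulr1 ln1 mulr0.
Qed.

Definition dyadic_density k (x : R) : R := 2 ^+ k * mass f k (dy k x).

Lemma dyadic_density_ge0 k x : 0 <= dyadic_density k x.
Proof. by rewrite mulr_ge0 ?mass_ge0// exprn_ge0. Qed.

Lemma measurable_xlnx1_dyadic k (D : set R) :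
  measurable_fun D (fun x => (xlnx1 (dyadic_density k x))%:E).
Proof.
apply/measurable_EFinP/measurable_funTS/discrete_measurable.
apply: (discrete_comp (fun j => xlnx1 (2 ^+ k * mass f k j))).
exact: discrete_dy.
Qed.

Lemma integral_xlnx1_dyadic k :
  (\int[mu]_(x in `]0%R, 1%R[%classic) (xlnx1 (dyadic_density k x))%:E =
   (dyadic_entropy k + 1)%:E)%E.
Proof.
rewrite dyadic_entropyE -sumEFin -(integral_pieces k); last 2 first.
- exact: measurable_xlnx1_dyadic.
- by move=> x _; rewrite lee_fin xlnx1_ge0// dyadic_density_ge0.
apply: eq_bigr => j _.
transitivity (\int[mu]_(x in piece k j) (xlnx1 (2 ^+ k * mass f k j))%:E)%E.
  by apply: eq_integral => x; rewrite inE => -[/= /eqP xj _]; rewrite /dyadic_density xj.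
by rewrite integral_piece_cst.
Qed.

(* The dyadic interval of length 2^-k around x, and any interval of that
   length when x < 0. *)
Let left_end (x : R) k : R := if 0 <= x then (dy k x)%:R / 2 ^+ k else x.

Let dyadic_itv (x : R) k : set R := `[left_end x k, left_end x k + 2 ^- k[%classic.

Let left_endP x k : left_end x k <= x < left_end x k + 2 ^- k.
Proof.
rewrite /left_end; case: ifP => x0; last by rewrite lexx ltrDl invr_gt0 exprn_gt0.
by have := eqxx (dy k x); rewrite dyE// -[(dy k x).+1%:R]natr1 mulrDl mul1r.
Qed.

Let measure_dyadic_itv x k : mu (dyadic_itv x k) = (2 ^- k)%:E.
Proof.
rewrite lebesgue_measure_itv /= lte_fin ltrDl invr_gt0 exprn_gt0//.
by rewrite -EFinB addrAC subrr add0r.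
Qed.

Let dyadic_itv_nice x : nicely_shrinking x (dyadic_itv x).
Proof.
split; first by move=> k; exact: measurable_itv.
have p k : 0 < 2 ^- k :> R by rewrite invr_gt0 exprn_gt0.
(* The interval lies in the ball of radius 2^-k around x, whose measure is twice as large. *)
exists (2, fun k => PosNum (p k)); split => //=.
- rewrite (_ : (fun i => _) = fun i => (2^-1) ^+ i); last by apply/funext => i; rewrite exprVn.
  by apply: cvg_expr; rewrite ger0_norm// invf_lt1// ltr1n.
- move=> k y; rewrite /dyadic_itv /= in_itv /= => /andP[y1 y2].
  have /andP[x1 x2] := left_endP x k.
  by rewrite /ball /= ltr_norml; apply/andP; split; lra.
move=> k; rewrite lebesgue_measure_ball; last exact/ltW.
rewrite measure_dyadic_itv.
change ((2 ^- k *+ 2)%:E <= (2 * 2 ^- k)%:E :> \bar R)%E.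
by rewrite lee_fin -[_ *+ 2]mulr_natl.
Qed.

Let dyadic_itv_piece x k : (`]0, 1[%classic : set R) x ->
  dyadic_itv x k `&` `]0, 1[%classic = piece k (dy k x).
Proof.
rewrite /= in_itv /= => /andP[x0 x1]; rewrite /dyadic_itv /left_end (ltW x0).
apply/seteqP; split => y [/=]; rewrite !in_itv /=.
  move=> yk /andP[y0 y1]; split; rewrite /= ?in_itv /= ?y0//.
  by rewrite /dyadic dyE ?(ltW y0)// -[(dy k x).+1%:R]natr1 mulrDl mul1r.
move=> + /andP[y0 y1]; rewrite /dyadic dyE ?(ltW y0)// -[(dy k x).+1%:R]natr1 mulrDl mul1r => yk.
by split=> //; rewrite y0.
Qed.

(** Lebesgue differentiation for f extended by 0 outside (0,1): the dyadic intervals around x are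
    not centred at x, but shrink nicely to it. *)
Lemma dyadic_density_cvg : {ae mu, forall x, (`]0%R, 1%R[%classic : set R) x ->
  dyadic_density ^~ x @ \oo --> f x}.
Proof.
have fint : mu.-integrable `]0%R, 1%R[%classic (EFin \o f).
  apply/integrableP; split; first exact/measurable_EFinP.
  rewrite [X in (X < _)%E](_ : _ = 1%E) ?ltry// -f1.
  by apply: eq_integral => x; rewrite inE => /f0 fx; rewrite /= ger0_norm.
have floc : locally_integrable setT (f \_ `]0%R, 1%R[%classic).
  exact: integrable_locally_restrict.
have [A [mA A0 sA]] := lebesgue_differentiation floc; exists A; split => //.
apply: subset_trans sA => x /= nP fx; apply: nP => x01.
have := nice_lebesgue_differentiation dyadic_itv_nice floc fx.
rewrite patchE mem_set// (_ : (fun n => _) = fun k => (dyadic_density k x)%:E).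
  by move=> H; exact: (fine_cvg H).
apply/funext => k; rewrite measure_dyadic_itv.
have -> : (\int[mu]_(y in dyadic_itv x k) ((f \_ `]0%R, 1%R[%classic) y)%:E = (mass f k (dy k x))%:E)%E.
  transitivity (\int[mu]_(y in dyadic_itv x k) (((fun y => (f y)%:E) \_ `]0%R, 1%R[%classic) y))%E.
    by apply: eq_integral => y _; rewrite !patchE; case: ifP.
  by rewrite -integral_mkcondr dyadic_itv_piece// -massE.
rewrite inver gt_eqF ?invr_gt0 ?exprn_gt0// invrK -EFinM.
by [].
Qed.

Lemma dyadic_entropy_cvg : dyadic_entropy @ \oo --> nat_entropy.
Proof.
suff H : (fun k => (dyadic_entropy k + 1)%:E) @ \oo --> (nat_entropy + 1)%:E.
  have {}H : (fun k => dyadic_entropy k + 1) @ \oo --> nat_entropy + 1 by exact: (fine_cvg H).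
  rewrite -[X in _ --> X](addrK 1 nat_entropy) (_ : dyadic_entropy = fun k => dyadic_entropy k + 1 - 1).
    by apply: cvgB => //; exact: cvg_cst.
  by apply/funext => k; rewrite addrK.
set u := fun k => _; pose J : \bar R := (nat_entropy + 1)%:E.
have uJ k : (u k <= J)%E by rewrite lee_fin lerD2r dyadic_entropy_le.
have eu k : (einfs u k <= u k)%E.
  by apply: ereal_inf_lbound; exists k => /=.
have cvge : cvgn (einfs u) by exact: is_cvg_einfs.
have le : (J <= limn_einf u)%E.
  have [A [mA A0 sA]] := dyadic_density_cvg.
  (* Off the null set A the averages converge at every point, so the lower limit of the integrands
     can be computed pointwise. *)
  pose D : set R := (`]0, 1[%classic : set R) `\` A.
  have mD : measurable D by exact: measurableD.
  have F := @fatou _ _ _ mu _ mD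
    (fun k x => (xlnx1 (dyadic_density k x))%:E) (fun k => @measurable_xlnx1_dyadic k _)
    (fun k x _ => xlnx1_ge0 (dyadic_density_ge0 k x)).
  have {F} : (\int[mu]_(x in D) (xlnx1 (f x))%:E <= limn_einf u)%E.
    apply: le_trans (le_trans F _).
      rewrite le_eqVlt; apply/orP; left; apply/eqP; apply: eq_integral => x.
      rewrite inE => -[x01 nA].
      have fx : dyadic_density ^~ x @ \oo --> f x.
        by apply: contrapT => nf; apply: nA; apply: sA => /= /(_ x01).
      have {}fx : (fun k => (xlnx1 (dyadic_density k x))%:E) @ \oo --> (xlnx1 (f x))%:E.
        apply: cvg_EFin; first by apply: nearW.
        apply: cvgD; last exact: cvg_cst.
        apply: xlnx_cvg => //; [by move=> k; exact: dyadic_density_ge0|exact: f0].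
      by have [-> _] := cvg_limn_einf_sup fx.
    rewrite le_eqVlt; apply/orP; left; apply/eqP; congr limn_einf; apply/funext => k.
    rewrite /u -integral_xlnx1_dyadic; apply/esym/ge0_negligible_integral => //.
    - exact: measurable_xlnx1_dyadic.
    - by move=> x _; rewrite lee_fin xlnx1_ge0// dyadic_density_ge0.
  apply: le_trans; rewrite /J -integral_xlnx1.
  rewrite le_eqVlt; apply/orP; left; apply/eqP; apply: ge0_negligible_integral => //.
  exact/measurable_EFinP.
have limE : limn (einfs u) = J.
  apply/eqP; rewrite eq_le -limn_einf_lim le andbT limn_einf_lim.
  apply: lime_le => //; apply: nearW => k; exact: le_trans (eu k) (uJ k).
(* The sequence lies between its tail infima, which converge to J, and J itself. *)
apply: (@squeeze_cvge _ _ _ _ (einfs u) u (cst J)).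
- by apply: nearW => k; rewrite eu uJ.
- by move: cvge; rewrite limE.
- exact: cvg_cst.
Qed.

End Entropy.

(** * Summing the cost over the levels *)

Section FinalEstimates.
Context {R : realType}.
Implicit Types (f : R -> R) (lambda th : R).
Local Notation mu := (@lebesgue_measure R).

Definition level_cost f lambda k : R := \sum_(j < 2 ^ k) qs_poisson (lambda * mass f k j).

Lemma level_cost_ge0 f lambda k : is_density01 f -> 0 <= lambda ->
  0 <= level_cost f lambda k.
Proof.
by move=> df l0; apply: sumr_ge0 => j _; rewrite qs_poisson_ge0// mulr_ge0// mass_ge0.
Qed.

(** The right side telescopes with increments 2 / ((1 + n) (2 + n)), which are at least (1 +
    n)^-2. *)
Lemma sum_inv_sqr n : \sum_(0 <= j < n) (1 + j%:R) ^- 2 <= 2 - 2 / (1 + n%:R) :> R.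
Proof.
elim: n => [|n IH]; first by rewrite big_geq// addr0 divr1 subrr.
rewrite big_nat_recr//= (le_trans (lerD IH (lexx _)))//.
rewrite -[n.+1%:R]natr1 addrCA -[in leRHS]addrA.
have : 0 <= n%:R :> R by [].
move: (n%:R : R) => x x0; rewrite -subr_ge0.
rewrite (_ : _ - _ = x / ((1 + x) ^+ 2 * (1 + (x + 1)))); last first.
  by field; apply/andP; split; rewrite gt_eqF//; lra.
by rewrite divr_ge0// mulr_ge0// ?exprn_ge0//; lra.
Qed.

(** The condition on K reads lambda <= 2 * 2^K, which is the origin of the factor 2 in both
    arguments of the minimum in [sum_mass_tail]; level j + K has offset j. *)
Lemma level_cost_tail f : is_density01 f ->
  (\int[mu]_(x in `]0%R, 1%R[%classic) (f x * lnp (f x) ^+ 4)%:E < +oo)%E ->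
  exists2 D : R, 0 < D & forall lambda K, 0 < lambda -> lambda <= 2 ^+ K.+1 ->
    exists2 r : R, 0 <= r <= D * lambda &
    (\sum_(k <oo) (level_cost f lambda k)%:E =
     (\sum_(k < K) level_cost f lambda k + r)%:E)%E.
Proof.
move=> df fin; have [C C0 HC] := sum_mass_tail df fin.
have [B B0 HB] := @qs_poisson_le R.
(* The 2 bounds the sum of (1 + j)^-2. *)
exists (2 * (B * C)); first by rewrite !mulr_gt0.
move=> lambda K l0 lK.
have lc0 k : 0 <= level_cost f lambda k by rewrite level_cost_ge0// ltW.
have tail j : level_cost f lambda (j + K) <= B * lambda * C * (1 + j%:R) ^- 2.
  rewrite -mulrA; apply: le_trans (_ : B * lambda * \sum_(i < 2 ^ (j + K)) mass f (j + K) i *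
    Num.min (2 / 2 ^+ j * (2 ^+ (j + K) * mass f (j + K) i)) (1 + lnp (2 * (2 ^+ (j + K) * mass f (j + K) i))) <= _); last first.
    by apply: ler_wpM2l (HC _ _); apply: mulr_ge0; exact: ltW.
  rewrite mulr_sumr; apply: ler_sum => i _.
  have m0 := mass_ge0 df (j + K) i; set m := mass f _ _ in m0 *.
  have lm0 : 0 <= lambda * m by rewrite mulr_ge0// ltW.
  apply: (le_trans (HB _ lm0)).
  rewrite -!mulrA ler_wpM2l ?(ltW B0)// ler_wpM2l ?(ltW l0)// ler_wpM2l//.
  have le1 : lambda * m <= 2 / 2 ^+ j * (2 ^+ (j + K) * m).
    rewrite exprD mulrA ler_wpM2r// (le_trans lK)// exprS mulrA divfK//.
  have le2 : lambda * m <= 2 * (2 ^+ (j + K) * m).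
    apply: (le_trans le1); rewrite ler_wpM2r ?mulr_ge0 ?exprn_ge0//.
    by rewrite ler_pdivrMr ?exprn_gt0// ler_peMr// exprn_ege1// ler1n.
  rewrite -mulrA in le1.
  rewrite le_min !ge_min le1 /=; apply/orP; right.
  by rewrite lerD2l le_lnp.
rewrite (nneseries_split 0 K); last by move=> k _; rewrite lee_fin.
rewrite add0n big_mkord sumEFin.
have tail0 : (0 <= \sum_(K <= k <oo) (level_cost f lambda k)%:E)%E.
  by apply: nneseries_ge0 => k _ _; rewrite lee_fin.
have tail1 : (\sum_(K <= k <oo) (level_cost f lambda k)%:E <= (2 * (B * C) * lambda)%:E)%E.
  apply: lime_le; first by apply: is_cvg_nneseries => k _ _; rewrite lee_fin.
  exists K => // n /= Kn; rewrite sumEFin lee_fin -(subnK Kn) -{1}[K]add0n big_addn addnK.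
  apply: (le_trans (ler_sum _ (fun j _ => tail j))).
  rewrite -mulr_sumr.
  have p : 0 <= B * lambda * C by rewrite !mulr_ge0// ltW.
  have S : \sum_(0 <= j < n - K) (1 + j%:R) ^- 2 <= 2 :> R.
    apply: (le_trans (sum_inv_sqr _)); rewrite lerBlDr lerDl divr_ge0// addr_ge0//.
  apply: (le_trans (ler_wpM2l p S)).
  by rewrite le_eqVlt; apply/orP; left; apply/eqP; ring.
have tf : (\sum_(K <= k <oo) (level_cost f lambda k)%:E)%E \is a fin_num.
  by rewrite ge0_fin_numE// (le_lt_trans tail1)// ltry.
exists (fine (\sum_(K <= k <oo) (level_cost f lambda k)%:E)%E).
  by rewrite fine_ge0//= -lee_fin fineK.
by rewrite EFinD fineK.
Qed.

(** The constant A is paid once per interval, hence 2^k times. Neither c nor A depends on the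
    density, so that two densities can be compared. *)
Lemma level_cost_asymp : exists c : R, forall th, 0 < th ->
  exists2 A, 0 <= A & forall f, is_density01 f -> forall lambda k, 0 < lambda ->
  `|level_cost f lambda k -
    lambda * (2 * dyadic_entropy f k + (2 * ln (lambda / 2 ^+ k) + c))|
  <= th * lambda + 2 ^+ k * A.
Proof.
have [c hc] := @qs_poisson_asymp R; exists c => th th0.
have [A A0 hA] := hc th th0; exists A => // f df lambda k l0.
have p : 0 < 2 ^+ k :> R by rewrite exprn_gt0.
have -> : lambda * (2 * dyadic_entropy f k + (2 * ln (lambda / 2 ^+ k) + c)) =
    \sum_(j < 2 ^ k) lambda * mass f k j * (2 * ln (lambda * mass f k j) + c).
  rewrite [X in lambda * (_ + X)](_ : _ =
      \sum_(j < 2 ^ k) mass f k j * (2 * ln (lambda / 2 ^+ k) + c)); last first.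
    by rewrite -mulr_suml sum_mass// mul1r.
  rewrite /dyadic_entropy mulr_sumr -big_split mulr_sumr; apply: eq_bigr => j _ /=.
  have := mass_ge0 df k j; rewrite le_eqVlt => /predU1P[<-|m0].
    by rewrite !(mul0r, mulr0) addr0 mulr0.
  rewrite !lnM ?posrE ?invr_gt0// lnV ?posrE//.
  by move: (mass f k j) (ln _) (ln (2 ^+ k)) (ln lambda) => m x y z; ring.
rewrite /level_cost -sumrB (le_trans (ler_norm_sum _ _ _))//.
apply: le_trans (_ : \sum_(j < 2 ^ k) (th * lambda * mass f k j + A) <= _).
  apply: ler_sum => j _; rewrite -[th * lambda * _]mulrA; apply: hA.
  by rewrite mulr_ge0 ?mass_ge0// ltW.
rewrite big_split /= -mulr_sumr sum_mass// mulr1 sumr_const card_ord.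
by rewrite -[A *+ _]mulr_natl natrX.
Qed.

Lemma dyadic_entropy_unif k : dyadic_entropy (fun=> 1 : R) k = 0.
Proof.
rewrite /dyadic_entropy big1// => j _; rewrite mass_unif// divff ?ln1 ?mulr0//.
Qed.

Lemma sum_pow2 K : \sum_(k < K) 2 ^+ k <= 2 ^+ K :> R.
Proof.
elim: K => [|K IH]; first by rewrite big_ord0.
by rewrite big_ord_recr /= exprS; move: IH; lra.
Qed.

(** The uniform density has dyadic entropy 0, and the terms 2 ln (lambda / 2^k) + c cancel in the
    difference. The errors 2^k A add up to O(lambda) because 2^K <= lambda. *)
Lemma level_cost_diff f : is_density01 f -> forall th, 0 < th ->
  exists2 A, 0 <= A & forall lambda K, 0 < lambda -> 2 ^+ K <= lambda ->
  `|\sum_(k < K) level_cost f lambda k - \sum_(k < K) level_cost (fun=> 1) lambda k -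
    2 * lambda * \sum_(k < K) dyadic_entropy f k| <=
  2 * th * lambda * K%:R + A * lambda.
Proof.
move=> df th th0; have [c /(_ th th0)[A A0 hA]] := level_cost_asymp.
exists (2 * A); first by rewrite mulr_ge0.
move=> lambda K l0 Kl; rewrite -sumrB mulr_sumr -sumrB.
apply: (le_trans (ler_norm_sum _ _ _)).
apply: le_trans (_ : \sum_(k < K) (2 * th * lambda + 2 * A * 2 ^+ k) <= _).
  apply: ler_sum => k _.
  have h1 := hA f df lambda k l0; have := hA (fun=> 1) density_unif lambda k l0.
  rewrite dyadic_entropy_unif mulr0 add0r => h2.
  move: h1 h2; set a := level_cost f lambda k; set b := level_cost _ lambda k.
  set e := dyadic_entropy f k; set l := ln _; clearbody a b e l => h1 h2.
  rewrite (_ : _ - _ = (a - lambda * (2 * e + (2 * l + c))) - (b - lambda * (2 * l + c))); last by ring.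
  by rewrite (le_trans (ler_normB _ _))//; move: h1 h2; lra.
rewrite big_split /= sumr_const card_ord -[_ *+ K]mulr_natr -mulr_sumr lerD2l.
rewrite ler_wpM2l ?mulr_ge0//; exact: le_trans (sum_pow2 K) Kl.
Qed.

Lemma mean_dyadic_entropy_cvg f : is_density01 f ->
  (\int[mu]_(x in `]0%R, 1%R[%classic) (f x * lnp (f x) ^+ 4)%:E < +oo)%E ->
  forall th, 0 < th -> exists K0 : nat, forall K, (K0 <= K)%N ->
  `|\sum_(k < K) dyadic_entropy f k - K%:R * nat_entropy f| <= th * K%:R.
Proof.
move=> df fin th th0.
have /cesaro/cvgrPdist_le/(_ _ th0)[K0 _ hK0] := dyadic_entropy_cvg df fin.
exists K0.+1 => -[//|K] KK; have := hK0 K KK.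
have K1 : 0 < K.+1%:R :> R by [].
rewrite /arithmetic_mean /= /series /= big_mkord distrC => h.
rewrite -ler_pdivrMr// -[X in _ / X]gtr0_norm// -normfV -normrM.
by rewrite mulrBl [_ * _ / _]mulrAC divff ?gt_eqF// mul1r [_ / _]mulrC.
Qed.

Lemma binary_log_floor lambda : 1 <= lambda ->
  let K := Num.truncn (ln lambda / ln 2) in
  [/\ 2 ^+ K <= lambda, lambda <= 2 ^+ K.+1,
      K%:R <= ln lambda / ln 2 & ln lambda / ln 2 <= K%:R + 1].
Proof.
move=> l1 K; have l0 : 0 < lambda by exact: lt_le_trans ltr01 l1.
have /andP[l2 _] := @ln2_bounds R; have l20 : 0 < ln 2 :> R by lra.
have q0 : 0 <= ln lambda / ln 2 by apply: divr_ge0; [exact: ln_ge0|exact: ltW].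
have /andP[k1 k2] := truncn_itv q0; rewrite -/K in k1 k2.
have e n : 2 ^+ n = expR (n%:R * ln 2) :> R by rewrite expRM_natl lnK ?posrE.
split=> //; last by rewrite natr1 ltW.
  by rewrite -[leRHS]lnK ?posrE// e ler_expR -ler_pdivlMr.
by rewrite -[leLHS]lnK ?posrE// e ler_expR -ler_pdivrMr// ltW.
Qed.

End FinalEstimates.

(** Here l is ln 2, L is lg lambda, K its integer part and H the entropy in nats. With th = e l / 8,
    the errors 4 th lambda K take up half of e; the other half pays for the terms O(lambda),
    including 2 lambda H from replacing K by L. *)
Lemma mean_difference_bound (R : realFieldType)
    (a b s r r' H L K A D D' e l lambda : R) :
  0 <= lambda -> 0 <= H -> 0 < e -> 0 < l -> 0 <= K -> K <= L <= K + 1 ->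
  0 <= r <= D * lambda -> 0 <= r' <= D' * lambda ->
  `|a - b - 2 * lambda * s| <= 2 * (e * l / 8) * lambda * K + A * lambda ->
  `|s - K * H| <= e * l / 8 * K ->
  2 * (A + D + D' + 2 * H) / e <= L * l ->
  `|a + r - (b + r' + 2 * (H / l) * (lambda * (L * l)))| <= e * (lambda * (L * l)).
Proof.
move=> l0 H0 e0 ll0 K0 /andP[KL LK] /andP[r0 rD] /andP[r'0 r'D].
set th := e * l / 8 => h1 h2 hW.
have th0 : 0 < th by rewrite /th divr_gt0// mulr_gt0.
have -> : 2 * (H / l) * (lambda * (L * l)) = 2 * lambda * (H * L).
  by field; rewrite gt_eqF.
have h3 : `|2 * lambda * s - 2 * lambda * (K * H)| <= 2 * lambda * (th * K).
  by rewrite -mulrBr normrM ger0_norm ?ler_wpM2l ?mulr_ge0.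
have h4 : `|2 * lambda * (K * H) - 2 * lambda * (H * L)| <= 2 * lambda * H.
  rewrite -mulrBr normrM ger0_norm ?mulr_ge0// ler_wpM2l ?mulr_ge0//.
  rewrite mulrC -mulrBr normrM ger0_norm// ler_piMr// ler_norml.
  by apply/andP; split; lra.
have h5 : `|r - r'| <= (D + D') * lambda.
  by rewrite ler_norml; apply/andP; split; lra.
have h6 : 4 * th * lambda * K <= e / 2 * (lambda * (L * l)).
  rewrite (_ : e / 2 * (lambda * (L * l)) = 4 * th * lambda * L); last by rewrite /th; field.
  by rewrite ler_wpM2l// !mulr_ge0// ltW.
have h7 : (A + D + D' + 2 * H) * lambda <= e / 2 * (lambda * (L * l)).
  move: hW; rewrite ler_pdivrMr// => h.
  have := ler_wpM2l l0 h; lra.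
rewrite (_ : _ - _ = (a - b - 2 * lambda * s) + (2 * lambda * s - 2 * lambda * (K * H))
  + (2 * lambda * (K * H) - 2 * lambda * (H * L)) + (r - r')); last by ring.
rewrite (le_trans (ler_normD _ _))// (le_trans (lerD (ler_normD _ _) (lexx _)))//.
rewrite (le_trans (lerD (lerD (ler_normD _ _) (lexx _)) (lexx _)))//.
lra.
Qed.

Theorem theorem1p3 (R : realType) (f : R -> R) (mu_f mu_unif : R -> \bar R)
    (f_density : is_density01 f)
    (f_integrability :
      (\int[@lebesgue_measure R]_(x in `]0%R, 1%R[%classic)
         (f x * lnp (f x) ^+ 4)%:E < +oo)%E)
    (mu_fE : forall lambda : R, 0 < lambda ->
      is_mean_bit_comparisons f lambda (mu_f lambda))
    (mu_unifE : forall lambda : R, 0 < lambda ->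
      is_mean_bit_comparisons (fun=> 1) lambda (mu_unif lambda)) :
  [/\ (0 <= entropy f < +oo)%E,
      (forall lambda : R, 0 < lambda ->
         mu_f lambda \is a fin_num /\ mu_unif lambda \is a fin_num) &
      (fun lambda : R => fine (mu_f lambda))
        = (fun lambda : R => fine (mu_unif lambda)
             + 2 * fine (entropy f) * (lambda * ln lambda))
          +o_ (pinfty_nbhs R) (fun lambda : R => lambda * ln lambda)].
Proof.
have unif_int : (\int[@lebesgue_measure R]_(x in `]0%R, 1%R[%classic)
    (1 * lnp 1 ^+ 4)%:E < +oo :> \bar R)%E.
  rewrite (_ : 1 * lnp 1 ^+ 4 = 0 :> R) ?integral0 ?ltry//.
  by rewrite /lnp ln1 maxxx expr0n mulr0.
have [D D0 HD] := level_cost_tail f_density f_integrability.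
have [D' D'0 HD'] := level_cost_tail density_unif unif_int.
have cost g lambda : (\sum_(k <oo) \sum_(j < 2 ^ k) (qs_poisson (lambda * mass g k j))%:E =
    \sum_(k <oo) (level_cost g lambda k)%:E :> \bar R)%E.
  by apply: eq_eseriesr => k _; rewrite sumEFin.
have muf lambda K : 0 < lambda -> lambda <= 2 ^+ K.+1 -> exists2 r : R, 0 <= r <= D * lambda &
    mu_f lambda = (\sum_(k < K) level_cost f lambda k + r)%:E.
  move=> l0 lK; have [r hr E] := HD lambda K l0 lK; exists r => //; rewrite -E -cost.
  exact: (mean_bit_comparisonsE f_density f_integrability l0 (mu_fE lambda l0)).
have muu lambda K : 0 < lambda -> lambda <= 2 ^+ K.+1 -> exists2 r : R, 0 <= r <= D' * lambda &
    mu_unif lambda = (\sum_(k < K) level_cost (fun=> 1) lambda k + r)%:E.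
  move=> l0 lK; have [r hr E] := HD' lambda K l0 lK; exists r => //; rewrite -E -cost.
  exact: (mean_bit_comparisonsE density_unif unif_int l0 (mu_unifE lambda l0)).
have /andP[l2 l2'] := @ln2_bounds R; have l20 : 0 < ln 2 :> R by lra.
have H0 := nat_entropy_ge0 f_density f_integrability.
have entE := entropyE f_density f_integrability.
split.
- by rewrite entE lee_fin ltry andbT divr_ge0// ltW.
- move=> lambda l0.
  (* Finiteness at a fixed lambda only needs some K with lambda <= 2^(K+1). *)
  have lK : lambda <= 2 ^+ (Num.truncn lambda).+1.
    rewrite ltW// (lt_trans (truncnS_gt _))// -natrX ltr_nat ltn_expl//.
  by have [r _ ->] := muf lambda _ l0 lK; have [r' _ ->] := muu lambda _ l0 lK.
apply/eqaddoP => e e0; rewrite entE /=.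
set H := nat_entropy f in H0 *.
pose th := e * ln 2 / 8; have th0 : 0 < th by rewrite /th divr_gt0// mulr_gt0.
have [A A0 hA] := level_cost_diff f_density th0.
have [K0 hK0] := mean_dyadic_entropy_cvg f_density f_integrability th0.
pose W := A + D + D' + 2 * H.
have W0 : 0 <= W by rewrite /W; lra.
(* ln lambda >= K0 forces K >= K0, as ln 2 <= 1, and ln lambda >= 2 W / e absorbs the O(lambda)
   terms. *)
exists (expR (K0%:R + 2 * W / e)); split; first exact: num_real.
move=> lambda lbig.
have We : 0 <= 2 * W / e by rewrite divr_ge0 ?mulr_ge0// ltW.
have K00 : 0 <= K0%:R :> R by [].
have l1 : 1 <= lambda.
  by rewrite (le_trans _ (ltW lbig))// -[leLHS]expR0 ler_expR addr_ge0.
have l0 : 0 < lambda by exact: lt_le_trans ltr01 l1.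
have lnl : K0%:R + 2 * W / e <= ln lambda by rewrite -ler_expR lnK ?posrE// ltW.
have [] := binary_log_floor l1; set L := ln lambda / ln 2; set K := Num.truncn L.
move=> Kl lK KL LK; have K0' : 0 <= K%:R :> R by [].
have KK0 : (K0 <= K)%N.
  rewrite truncn_ge_nat; last by apply: divr_ge0; [exact: ln_ge0|exact: ltW].
  rewrite ler_pdivlMr// (le_trans _ lnl)// -[leLHS]addr0 lerD// ler_piMr//.
have lnE : ln lambda = L * ln 2 by rewrite /L divfK// gt_eqF.
have [r hr muE] := muf lambda K l0 lK; have [r' hr' muE'] := muu lambda K l0 lK.
rewrite [X in e * X]ger0_norm; last by rewrite mulr_ge0 ?ln_ge0// ltW.
rewrite [X in `|X|](_ : _ = fine (mu_f lambda) - (fine (mu_unif lambda)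
  + 2 * (H / ln 2) * (lambda * ln lambda)))// muE muE' lnE.
apply: (mean_difference_bound (ltW l0) H0 e0 l20 K0' _ hr hr' (hA _ _ l0 Kl) (hK0 K KK0)).
- by rewrite KL.
- by rewrite -lnE (le_trans _ lnl)// lerDr.
Qed.
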